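(* Let $n\in\mathbb N$, let $A$ be an $n\times n$ complex matrix all of whose eigenvalues have positive real parts, and let $G:\mathbb C^n\to\mathbb C^n$, $G\sim\sum_{m\ge2}G_m$, $G_m(x)=\mathcal G_m(x,\dots,x)$, be as in the context. Let $f:(0,\infty)\to\mathbb C^n$ be a function that is continuous on $[T_f,\infty)$ for some $T_f\ge 0$. Let $(\mu_k)_{k=1}^\infty$ be a divergent, strictly increasing sequence of positive numbers such that the set $\mathcal S=\{\mu_k:k\in\mathbb N\}$ satisfies $x+y\in\mathcal S$ for all $x,y\in\mathcal S$ and contains $\operatorname{Re}\sigma(A)=\{\operatorname{Re}\Lambda:\Lambda \text{ is an eigenvalue of }A\}$. Assume that $f$ admits the exponential asymptotic expansion $$f(t)\sim\sum_{k=1}^\infty f_k(t),\qquad f_k\in\mathcal F_E(-\mu_k,\mathbb C^n)\text{ for }k\in\mathbb N.$$ Let $T_0\ge 0$ and let $y\in C^1((T_0,\infty),\mathbb C^n)$ be a solution of $$y'=-Ay+G(y)+f(t)\quad\text{on }(T_0,\infty)$$ with $y(t)\to0$ as $t\to\infty$. Then there exist functions $y_k\in\mathcal F_E(-\mu_k,\mathbb C^n)$, $k\in\mathbb N$, such that $y$ admits the exponential asymptotic expansion $$y(t)\sim\sum_{k=1}^\infty y_k(t).$$ Moreover, for each $k\in\mathbb N$, the function $y_k$ solves $$y_k'+Ay_k=\sum_{m\ge2}\ \sum_{\mu_{j_1}+\mu_{j_2}+\cdots+\mu_{j_m}=\mu_k}\mathcal G_m(y_{j_1},y_{j_2},\ldots,y_{j_m})+f_k\quad\text{for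 }t\in\mathbb R.$$
   Context: $|\cdot|$ is the Euclidean norm. $u(t)=\mathcal O(h(t))$ means that there are $T,C>0$ with $|u(t)|\le Ch(t)$ for all $t\ge T$. Assumption on $G$: $G:\mathbb C^n\to\mathbb C^n$ is locally Lipschitz, and there exist functions $G_m:\mathbb C^n\to\mathbb C^n$, $m\ge 2$, each a homogeneous polynomial of degree $m$, such that for any $N\ge2$ there exists $\delta>0$ with $|G(x)-\sum_{m=2}^N G_m(x)|=\mathcal O(|x|^{N+\delta})$ as $x\to0$. For each $m\ge2$, $\mathcal G_m$ is an $m$-linear mapping (over $\mathbb C$) from $(\mathbb C^n)^m$ to $\mathbb C^n$ with $G_m(x)=\mathcal G_m(x,x,\ldots,x)$ for $x\in\mathbb C^n$. Class $\mathcal F_E$: for a complex linear space $X$ and $\mu\in\mathbb R$, $\mathcal F_E(\mu,X)$ is the set of functions $g:\mathbb R\to X$ of the form $g(t)=\sum_{\lambda\in S}p_\lambda(t)e^{\lambda t}$, where $S$ is a finite subset of $\mathbb C$ with $\operatorname{Re}\lambda=\mu$ for all $\lambda\in S$, and each $p_\lambda$ is a polynomial from $\mathbb R$ to $X$. Exponential asymptotic expansion: for a function $g$ from $(T,\infty)$ to a complex normed space $X$ and a divergent, strictly increasing sequence $(\gamma_k)_{k=1}^\infty$ of nonnegative numbers, one writes $g(t)\sim\sum_{k=1}^\infty g_k(t)$ with $g_k\in\mathcal F_E(-\gamma_k,X)$ if for any $N\ge1$ there exists $\mu>\gamma_N$ such that $\|g(t)-\sum_{k=1}^N g_k(t)\|_X=\mathcal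 O(e^{-\mu t})$. In the double sum, $m$ ranges over integers $\ge 2$ and $j_1,\ldots,j_m$ over $\mathbb N=\{1,2,\dots\}$ subject to the stated condition; the sum is finite, involves only indices $j_\ell\le k-1$, and is zero if no such indices exist. *)

(* Defs.v *)
From HB Require Import structures.
From mathcomp Require Import all_boot all_order all_algebra.
From mathcomp Require Import complex.
From mathcomp Require Import all_classical all_reals all_analysis.
From mathcomp Require mpoly.

Set Implicit Arguments.
Unset Strict Implicit.
Unset Printing Implicit Defensive.

Import Order.TTheory GRing.Theory Num.Theory.
Import numFieldNormedType.Exports.

Local Open Scope classical_set_scope.
Local Open Scope ring_scope.
Local Open Scope complex_scope.

(* In this development C is R[i] for an arbitrary R : realType and C^n is
   'cV[R[i]]_n.  All functions of time are total on R; only their values on the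
   intervals named in the hypotheses matter.  Sequences indexed by {1, 2, ...}
   on paper are indexed by nat here: index k stands for k + 1. *)

Section Definitions.
Variable R : realType.

Definition enorm (n : nat) (x : 'cV[R[i]]_n) : R :=
  Num.sqrt (\sum_(i < n) (complex.Re (x i 0) ^+ 2 + complex.Im (x i 0) ^+ 2)).

Definition cexp (z : R[i]) : R[i] :=
  (expR (complex.Re z))%:C * (cos (complex.Im z) +i* sin (complex.Im z)).

(* R[i] carries no normed space structure over R in the library, so continuity
   and differentiation of C^n-valued functions of a real variable are taken on
   the real and imaginary parts of the coordinates. *)
Definition vcontinuous (n : nat) (D : set R) (f : R -> 'cV[R[i]]_n) : Prop :=
  forall i : 'I_n,
    {within D, continuous (fun t => complex.Re (f t i 0))} /\
    {within D, continuous (fun t => complex.Im (f t i 0))}.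

Definition is_vderive (n : nat) (f : R -> 'cV[R[i]]_n) (t : R)
    (d : 'cV[R[i]]_n) : Prop :=
  forall i : 'I_n,
    is_derive t 1 (fun s => complex.Re (f s i 0)) (complex.Re (d i 0)) /\
    is_derive t 1 (fun s => complex.Im (f s i 0)) (complex.Im (d i 0)).

Definition vC1 (n : nat) (D : set R) (f : R -> 'cV[R[i]]_n) : Prop :=
  exists2 df : R -> 'cV[R[i]]_n,
    forall t, D t -> is_vderive f t (df t) & vcontinuous D df.

Definition bigO_infty (n : nat) (u : R -> 'cV[R[i]]_n) (h : R -> R) : Prop :=
  exists T C : R,
    [/\ 0 < T, 0 < C & forall t, T <= t -> enorm (u t) <= C * h t].

Definition locally_lipschitz (n : nat) (G : 'cV[R[i]]_n -> 'cV[R[i]]_n) : Prop :=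
  forall x, exists r L : R, 0 < r /\
    forall u v, enorm (u - x) < r -> enorm (v - x) < r ->
      enorm (G u - G v) <= L * enorm (u - v).

Definition homogeneous_polynomial (n m : nat)
    (P : 'cV[R[i]]_n -> 'cV[R[i]]_n) : Prop :=
  forall i : 'I_n, exists2 p : mpoly.mpoly n R[i],
    forall a, mpoly.mcoeff a p != 0 -> mpoly.mdeg a = m &
    forall x, P x i 0 = mpoly.meval (fun j => x j 0) p.

Definition multilinear (n m : nat)
    (M : ('I_m -> 'cV[R[i]]_n) -> 'cV[R[i]]_n) : Prop :=
  forall (w : 'I_m -> 'cV[R[i]]_n) (l : 'I_m) (a : R[i]) (u v : 'cV[R[i]]_n),
    M [eta w with l |-> a *: u + v] =
      a *: M [eta w with l |-> u] + M [eta w with l |-> v].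

(* The order of approximation N + delta is a real exponent, hence powR. *)
Definition power_expansion (n : nat) (G : 'cV[R[i]]_n -> 'cV[R[i]]_n)
    (Gm : nat -> 'cV[R[i]]_n -> 'cV[R[i]]_n) : Prop :=
  forall N : nat, (2 <= N)%N -> exists2 delta : R, 0 < delta &
    exists r C : R, [/\ 0 < r, 0 < C & forall x, enorm x < r ->
      enorm (G x - \sum_(2 <= m < N.+1) Gm m x)
        <= C * enorm x `^ (N%:R + delta)].

Definition polynomial_fun (X : lmodType R[i]) (p : R -> X) : Prop :=
  exists (d : nat) (a : nat -> X),
    forall t, p t = \sum_(k < d) (t ^+ k)%:C *: a k.

(* The class F_E(mu, X). *)
Definition FE (X : lmodType R[i]) (mu : R) (g : R -> X) : Prop :=
  exists (S : seq R[i]) (p : R[i] -> R -> X),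
    [/\ uniq S,
        {in S, forall lambda, complex.Re lambda = mu},
        {in S, forall lambda, polynomial_fun (p lambda)} &
        forall t, g t = \sum_(lambda <- S) cexp (lambda * t%:C) *: p lambda t].

(* The remainder estimate of g ~ sum_k g_k; the membership of the g_k in the
   classes FE (- gamma k) is stated separately. *)
Definition exp_expansion (n : nat) (gamma : nat -> R) (g : R -> 'cV[R[i]]_n)
    (gk : nat -> R -> 'cV[R[i]]_n) : Prop :=
  forall N : nat, exists2 mu : R, gamma N < mu &
    bigO_infty (fun t => g t - \sum_(k < N.+1) gk k t)
               (fun t => expR (- mu * t)).

(* The sums of [resonant_sum] are finitely supported sums over infinite index
   types, which default to 0 on infinite supports; by [finite_resonances] and
   [resonances_bounded] this never happens for mu positive and strictly
   increasing. *)
Definition resonances (mu : nat -> R) (k m : nat) : set {ffun 'I_m -> nat} :=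
  [set j : {ffun 'I_m -> nat} | \sum_(l < m) mu (j l) = mu k].

Definition resonant_sum (n : nat) (mu : nat -> R)
    (GG : forall m, ('I_m -> 'cV[R[i]]_n) -> 'cV[R[i]]_n)
    (y : nat -> R -> 'cV[R[i]]_n) (k : nat) (t : R) : 'cV[R[i]]_n :=
  \sum_(m \in [set m : nat | (2 <= m)%N])
    \sum_(j \in @resonances mu k m) GG m (fun l => y (j l) t).

End Definitions.

Lemma resonances_lt (R : realType) (mu : nat -> R) (mu_gt0 : forall k, 0 < mu k)
    (mu_incr : {homo mu : i j / (i < j)%N >-> i < j})
    (k m : nat) (j : {ffun 'I_m -> nat}) : (2 <= m)%N ->
  resonances mu k j -> forall l, (j l < k)%N.
Proof.
move=> m2 jk l; rewrite ltnNge; apply/negP => kj.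
have hle : mu k <= mu (j l).
  by move: kj; rewrite leq_eqVlt => /orP[/eqP->//|/mu_incr/ltW].
move: jk; rewrite /resonances /= (bigD1 l) //= => jk.
suff : 0 < \sum_(i < m | i != l) mu (j i).
  by rewrite -(ltrD2l (mu (j l))) addr0 jk ltNge hle.
have [l' ll'] : exists l' : 'I_m, l' != l.
  have m0 : (0 < m)%N by exact: leq_trans m2.
  case: (eqVneq l (Ordinal m0)) => [->|h]; last first.
    by exists (Ordinal m0); rewrite eq_sym.
  by exists (Ordinal m2); apply/eqP => /(congr1 val).
rewrite (bigD1 l') //= ltr_pwDl // sumr_ge0 // => i _; exact/ltW.
Qed.

Lemma finite_resonances (R : realType) (mu : nat -> R) (mu_gt0 : forall k, 0 < mu k)
    (mu_incr : {homo mu : i j / (i < j)%N >-> i < j})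
    (k m : nat) :
  (2 <= m)%N -> finite_set (@resonances R mu k m).
Proof.
move=> m2.
pose F (g : {ffun 'I_m -> 'I_k}) : {ffun 'I_m -> nat} := [ffun l => val (g l)].
apply: (@sub_finite_set _ _ (F @` setT)); last first.
  by apply: finite_image; exact: finite_finset.
move=> j jk; exists [ffun l => Ordinal (resonances_lt mu_gt0 mu_incr m2 jk l)] => //.
by apply/ffunP => l; rewrite !ffunE.
Qed.

Lemma resonances_bounded (R : realType) (mu : nat -> R) (mu_gt0 : forall k, 0 < mu k)
    (mu_incr : {homo mu : i j / (i < j)%N >-> i < j})
    (k : nat) :
  exists M : nat, forall m, (M <= m)%N -> @resonances R mu k m = set0.
Proof.
have [M hM] : exists M : nat, mu k / mu 0%N < M%:R.
  exists (Num.truncn (mu k / mu 0%N)).+1; exact: truncnS_gt.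
exists M => m Mm; rewrite -subset0 => j /= jk.
have : m%:R * mu 0%N <= mu k.
  rewrite -jk mulr_natl -[X in _ *+ X](card_ord m) -sumr_const ler_sum // => l _.
  by case: (j l) => // p; apply/ltW/mu_incr.
apply/negP; rewrite -ltNge -ltr_pdivrMr //.
by apply: lt_le_trans hM _; rewrite ler_nat.
Qed.

(* Main.v *)
(** Write [u_N = y - y_0 - ... - y_(N-1)].  If [u_N] decays like [exp (- nu t)]
    with [nu] just above [mu (N-1)], then expanding [G] and its multilinear parts
    shows that [u_N' = - A u_N + h_N + O(exp (- (mu N + e) t))], where [h_N] is the
    resonant sum plus [fk N], of exponential rate exactly [- mu N]: every other
    combination of rates is at least [mu (N+1)], because the rates form a semigroup.
    After a Schur triangularization the linear system is solved coordinate by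
    coordinate.  For a scalar equation [z' = - lam z + h + r], a particular
    quasi-polynomial solution is subtracted; the remainder times [exp (lam t)] either
    converges, and its limit is the free constant of [y_N] if [Re lam = mu N] and is
    zero if [Re lam < nu], or grows at a controlled rate.  The induction starts from a
    weighted quadratic Lyapunov function, which gives [y = O(exp (- a t))] for every
    [a < mu 0]. *)

Require Import Defs.
From HB Require Import structures.
From mathcomp Require Import all_boot all_order all_algebra.
From mathcomp Require Import complex.
From mathcomp Require Import all_classical all_reals all_analysis.
From mathcomp Require Import ring lra.

Set Implicit Arguments.
Unset Strict Implicit.
Unset Printing Implicit Defensive.

Import Order.TTheory GRing.Theory Num.Theory.
Import numFieldNormedType.Exports.

Local Open Scope classical_set_scope.
Local Open Scope ring_scope.
Local Open Scope complex_scope.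

(** A quasi-polynomial of exponent [- a] is [O(exp (- b t))] only for [b < a], because of its powers
    of [t]. No estimate can therefore be made at an exact rate: each stage keeps a rate [nu]
    strictly below the next exponent and above the previous ones, and the gain from quadratic terms
    has to come from some [a < mu 0] with [mu N < a + nu].

    The spectral hypothesis closes the gap from [nu] to [mu N]: an eigenvalue with real part there
    would allow in the remainder a free exponential that decays too slowly and that no [y_k] could
    absorb.

    The equations are never integrated. Limits and growth are read off from the monotonicity of a
    function corrected by an explicit primitive of the bound on its derivative.

    The free constants depend on the solution [y], so the [y_k] are chosen one after another. The
    right-hand side of the equation of [y_k] involves only smaller indices, hence later choices
    leave earlier equations intact. *)

Local Notation Re := complex.Re.
Local Notation Im := complex.Im.
Local Notation normc := ComplexField.Normc.normc.

(** * Complex scalars: modulus, exponential, derivatives, exponential bounds *)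

Section ComplexScalars.
Variable R : realType.
Implicit Types (x y z : R[i]) (r s t : R).

Lemma ReD x y : Re (x + y) = Re x + Re y.
Proof. by case: x; case: y. Qed.

Lemma ImD x y : Im (x + y) = Im x + Im y.
Proof. by case: x; case: y. Qed.

Lemma ReN x : Re (- x) = - Re x.
Proof. by case: x. Qed.

Lemma ImN x : Im (- x) = - Im x.
Proof. by case: x. Qed.

Lemma ReM x y : Re (x * y) = Re x * Re y - Im x * Im y.
Proof. by case: x; case: y. Qed.

Lemma ImM x y : Im (x * y) = Re x * Im y + Im x * Re y.
Proof. by case: x; case: y. Qed.

Lemma complexP x y : Re x = Re y -> Im x = Im y -> x = y.
Proof. by case: x => a b; case: y => c d /= -> ->. Qed.

Lemma normcE x : normc x = Num.sqrt (Re x ^+ 2 + Im x ^+ 2).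
Proof. by case: x. Qed.

Lemma normc_ge0 x : 0 <= normc x.
Proof. by rewrite normcE sqrtr_ge0. Qed.

Lemma normc_sqr x : normc x ^+ 2 = Re x ^+ 2 + Im x ^+ 2.
Proof. by rewrite normcE sqr_sqrtr // addr_ge0 // sqr_ge0. Qed.

Lemma normc_real r : normc r%:C = `|r|.
Proof. by rewrite normcE /= expr0n addr0 sqrtr_sqr. Qed.

Lemma Re_le_normc x : `|Re x| <= normc x.
Proof. by rewrite normcE -sqrtr_sqr ler_wsqrtr // lerDl sqr_ge0. Qed.

Lemma Im_le_normc x : `|Im x| <= normc x.
Proof. by rewrite normcE -sqrtr_sqr ler_wsqrtr // lerDr sqr_ge0. Qed.

Lemma normc_le x : normc x <= `|Re x| + `|Im x|.
Proof.
rewrite -(@ler_pXn2r _ 2) ?nnegrE ?addr_ge0 ?normc_ge0 //.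
rewrite normc_sqr sqrrD !real_normK ?num_real //.
have : 0 <= `|Re x| * `|Im x| by rewrite mulr_ge0.
by lra.
Qed.

Lemma normc_sum (I : Type) (r : seq I) (P : pred I) (F : I -> R[i]) :
  normc (\sum_(i <- r | P i) F i) <= \sum_(i <- r | P i) normc (F i).
Proof.
elim/big_rec2 : _ => [|i a b _ ih]; first by rewrite ComplexField.Normc.normc0.
by apply: le_trans (le_normcD _ _) _; rewrite lerD2l.
Qed.

Lemma normc_prod (I : Type) (r : seq I) (P : pred I) (F : I -> R[i]) :
  normc (\prod_(i <- r | P i) F i) = \prod_(i <- r | P i) normc (F i).
Proof.
elim/big_rec2 : _ => [|i a b _ <-]; first exact: ComplexField.Normc.normc1.
exact: ComplexField.Normc.normcM.
Qed.

Lemma cexpD x y : cexp (x + y) = cexp x * cexp y.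
Proof.
apply: complexP; rewrite /cexp ?ReM ?ImM /= ?ReD ?ImD expRD ?sinD ?cosD /=; ring.
Qed.

Lemma cexp0 : cexp (0 : R[i]) = 1.
Proof. by apply: complexP; rewrite /cexp /= expR0 ?cos0 ?sin0; ring. Qed.

Lemma cexpMN x t : cexp (x * t%:C) * cexp (- x * t%:C) = 1.
Proof. by rewrite -cexpD mulNr subrr cexp0. Qed.

Lemma normc_cexp x : normc (cexp x) = expR (Re x).
Proof.
rewrite /cexp ComplexField.Normc.normcM normc_real normcE /= cos2Dsin2 sqrtr1 mulr1.
by rewrite ger0_norm // expR_ge0.
Qed.

(** Each coordinate of [is_vderive] is by definition an instance of this, so vector statements pass
    to scalars by conversion. *)
Definition cderive (f : R -> R[i]) t (d : R[i]) : Prop :=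
  is_derive t 1 (fun s => Re (f s)) (Re d) /\
  is_derive t 1 (fun s => Im (f s)) (Im d).

Lemma cderive_eq f t d e : cderive f t d -> d = e -> cderive f t e.
Proof. by move=> ? <-. Qed.

Lemma cderive_cst x t : cderive (fun=> x) t 0.
Proof. by split; exact: is_derive_cst. Qed.

Lemma cderiveD f g t d e :
  cderive f t d -> cderive g t e -> cderive (fun s => f s + g s) t (d + e).
Proof.
move=> [fr fi] [gr gi]; split.
- rewrite ReD (_ : (fun s => Re (f s + g s)) = (fun s => Re (f s)) + (fun s => Re (g s))).
    exact: is_deriveD.
  by apply/funext => s; rewrite ReD.
- rewrite ImD (_ : (fun s => Im (f s + g s)) = (fun s => Im (f s)) + (fun s => Im (g s))).
    exact: is_deriveD.
  by apply/funext => s; rewrite ImD.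
Qed.

Lemma cderiveM f g t d e : cderive f t d -> cderive g t e ->
  cderive (fun s => f s * g s) t (d * g t + f t * e).
Proof.
move=> [fr fi] [gr gi]; split.
- have -> : (fun s => Re (f s * g s)) =
     (fun s => Re (f s)) * (fun s => Re (g s)) - (fun s => Im (f s)) * (fun s => Im (g s)).
    by apply/funext => s; rewrite ReM.
  apply: (is_derive_eq (is_deriveB (is_deriveM fr gr) (is_deriveM fi gi))).
  by rewrite ReD !ReM /GRing.scale /=; ring.
- have -> : (fun s => Im (f s * g s)) =
     (fun s => Re (f s)) * (fun s => Im (g s)) + (fun s => Im (f s)) * (fun s => Re (g s)).
    by apply/funext => s; rewrite ImM.
  apply: (is_derive_eq (is_deriveD (is_deriveM fr gi) (is_deriveM fi gr))).
  by rewrite ImD !ImM /GRing.scale /=; ring.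
Qed.

Lemma cderiveZ x f t d : cderive f t d -> cderive (fun s => x * f s) t (x * d).
Proof.
by move=> fd; apply: cderive_eq (cderiveM (cderive_cst x t) fd) _; rewrite mul0r add0r.
Qed.

Lemma cderiveN f t d : cderive f t d -> cderive (fun s => - f s) t (- d).
Proof.
move=> /(cderiveZ (-1)) fd; rewrite -mulN1r.
by rewrite (_ : (fun s => _) = (fun s => -1 * f s)) //; apply/funext => s; rewrite mulN1r.
Qed.

Lemma cderiveB f g t d e :
  cderive f t d -> cderive g t e -> cderive (fun s => f s - g s) t (d - e).
Proof. by move=> fd /cderiveN; exact: cderiveD. Qed.

Lemma cderive_sum (I : Type) (r : seq I) (P : pred I) (f : I -> R -> R[i])
    (d : I -> R[i]) t : (forall i, cderive (f i) t (d i)) ->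
  cderive (fun s => \sum_(i <- r | P i) f i s) t (\sum_(i <- r | P i) d i).
Proof.
move=> fd; elim: r => [|i r ih].
  rewrite big_nil (_ : (fun s => _) = (fun=> 0)); first exact: cderive_cst.
  by apply/funext => s; rewrite big_nil.
rewrite big_cons (_ : (fun s => _) =
    (fun s => if P i then f i s + \sum_(j <- r | P j) f j s
              else \sum_(j <- r | P j) f j s)); last first.
  by apply/funext => s; rewrite big_cons.
by case: (P i) => //; exact: cderiveD.
Qed.

Lemma is_derive_mull r t : is_derive t 1 (fun s => r * s) r.
Proof.
apply: (is_derive_eq (is_deriveZ r (is_derive_id t 1))).
by rewrite /GRing.scale /= mulr1.
Qed.

Lemma is_derive_expRM r t :
  is_derive t 1 (fun s => expR (r * s)) (r * expR (r * t)).
Proof.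
apply: (is_derive_eq (is_derive1_comp (is_derive_expR (r * t)) (is_derive_mull r t))).
by rewrite mulrC.
Qed.

Lemma cderive_cexp x t :
  cderive (fun s => cexp (x * s%:C)) t (x * cexp (x * t%:C)).
Proof.
have RexE s : Re (x * s%:C) = Re x * s by rewrite ReM /=; ring.
have ImxE s : Im (x * s%:C) = Im x * s by rewrite ImM /=; ring.
have -> : (fun s => cexp (x * s%:C)) = (fun s => (expR (Re x * s))%:C *
    (cos (Im x * s) +i* sin (Im x * s))).
  by apply/funext => s; rewrite /cexp RexE ImxE.
have dexp : cderive (fun s => (expR (Re x * s))%:C) t (Re x * expR (Re x * t))%:C.
  by split; [exact: is_derive_expRM | exact: is_derive_cst].
have dcs : cderive (fun s => cos (Im x * s) +i* sin (Im x * s)) t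
    ((- sin (Im x * t) * Im x) +i* (cos (Im x * t) * Im x)).
  split; first exact: (is_derive1_comp (is_derive_cos _) (is_derive_mull _ t)).
  exact: (is_derive1_comp (is_derive_sin _) (is_derive_mull _ t)).
apply: (cderive_eq (cderiveM dexp dcs)).
rewrite /cexp RexE ImxE.
by apply: complexP; rewrite ?ReD ?ImD !(ReM, ImM) /= ?ReM ?ImM /=; ring.
Qed.

Lemma cderive_pow k t :
  cderive (fun s => (s ^+ k)%:C) t ((k%:R * t ^+ k.-1)%:C).
Proof.
split => /=; last exact: is_derive_cst.
rewrite (_ : (fun s => s ^+ k) = (id : R -> R) ^+ k); last by rewrite exprfctE.
apply: (is_derive_eq (is_deriveX k (is_derive_id t 1))).
by rewrite /GRing.scale /= mulr1.
Qed.

(** No sign is required of [T] and [C], which keeps the closure lemmas short; [expO_bound] restores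
    positivity where it matters. *)
Definition expO (g : R -> R[i]) (a : R) : Prop :=
  exists T C : R, forall t, T <= t -> normc (g t) <= C * expR (- a * t).

Lemma expO_bound g a : expO g a -> exists T C : R,
  [/\ 0 < T, 0 < C & forall t, T <= t -> normc (g t) <= C * expR (- a * t)].
Proof.
move=> [T [C h]]; exists (`|T| + 1), (`|C| + 1); split; rewrite ?ltr_wpDl //.
move=> t Tt; apply: le_trans (h t _) _; first by have := ler_norm T; lra.
rewrite ler_wpM2r ?expR_ge0 //; have := ler_norm C; lra.
Qed.

Lemma expO_le g a b : b <= a -> expO g a -> expO g b.
Proof.
move=> ba /expO_bound[T [C [T0 C0 h]]]; exists T, C => t Tt.
apply: le_trans (h t Tt) _; rewrite ler_pM2l // ler_expR.
by rewrite ler_wpM2r ?lerN2 //; lra.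
Qed.

Lemma expO0 a : expO (fun=> 0) a.
Proof. by exists 0, 0 => t _; rewrite ComplexField.Normc.normc0 mul0r. Qed.

Lemma expOD f g a : expO f a -> expO g a -> expO (fun t => f t + g t) a.
Proof.
move=> [T [C h]] [T' [C' h']]; exists (Num.max T T'), (C + C') => t.
rewrite ge_max => /andP[Tt Tt']; apply: le_trans (le_normcD _ _) _.
by rewrite mulrDl lerD // ?h ?h'.
Qed.

Lemma expOM f g a b : expO f a -> expO g b -> expO (fun t => f t * g t) (a + b).
Proof.
move=> [T [C h]] [T' [C' h']]; exists (Num.max T T'), (C * C') => t.
rewrite ge_max => /andP[Tt Tt']; rewrite ComplexField.Normc.normcM.
have -> : C * C' * expR (- (a + b) * t) = C * expR (- a * t) * (C' * expR (- b * t)).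
  by rewrite opprD mulrDl expRD; ring.
by apply: ler_pM; rewrite ?normc_ge0 ?h ?h'.
Qed.

Lemma expOZ x f a : expO f a -> expO (fun t => x * f t) a.
Proof.
move=> [T [C h]]; exists T, (normc x * C) => t Tt.
by rewrite ComplexField.Normc.normcM -mulrA ler_wpM2l ?normc_ge0 ?h.
Qed.

Lemma expON f a : expO f a -> expO (fun t => - f t) a.
Proof. by move=> [T [C h]]; exists T, C => t Tt; rewrite normcN h. Qed.

Lemma expOB f g a : expO f a -> expO g a -> expO (fun t => f t - g t) a.
Proof. by move=> fa /expON; exact: expOD. Qed.

Lemma expO_eq f g a : expO f a -> f =1 g -> expO g a.
Proof. by move=> fa /funext <-. Qed.

Lemma expO_sum (I : Type) (r : seq I) (P : pred I) (f : I -> R -> R[i]) a :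
  (forall i, P i -> expO (f i) a) -> expO (fun t => \sum_(i <- r | P i) f i t) a.
Proof.
move=> fa; elim: r => [|i r ih].
  by apply: expO_eq (expO0 a) _ => t; rewrite big_nil.
have [Pi|/negbTE Pi] := boolP (P i).
  by apply: expO_eq (expOD (fa i Pi) ih) _ => t; rewrite big_cons Pi.
by apply: expO_eq ih _ => t; rewrite big_cons Pi.
Qed.

Lemma expO_cexp x : expO (fun t => cexp (x * t%:C)) (- Re x).
Proof.
by exists 0, 1 => t _; rewrite mul1r opprK normc_cexp ReM /= mulr0 subr0.
Qed.

End ComplexScalars.

(** * Quasi-polynomials whose exponents share one real part *)

Section Quasipolynomials.
Variable R : realType.
Implicit Types (x y z lam : R[i]) (a b r s t : R).

(* The class FE for scalar functions, presented term by term. *)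
Inductive qexp a : (R -> R[i]) -> Prop :=
| qexp0 : qexp a (fun=> 0)
| qexp_cons lam c k g : Re lam = a -> qexp a g ->
    qexp a (fun t => c * (t ^+ k)%:C * cexp (lam * t%:C) + g t).

Lemma qexp_eq a f g : qexp a f -> f =1 g -> qexp a g.
Proof. by move=> fa /funext <-. Qed.

Lemma qexp_mono a lam c k : Re lam = a ->
  qexp a (fun t => c * (t ^+ k)%:C * cexp (lam * t%:C)).
Proof.
by move=> la; apply: qexp_eq (qexp_cons c k la (qexp0 a)) _ => t; rewrite addr0.
Qed.

Lemma qexpD a f g : qexp a f -> qexp a g -> qexp a (fun t => f t + g t).
Proof.
move=> fa ga; elim: fa => [|lam c k h la ha ih].
  by apply: qexp_eq ga _ => t; rewrite add0r.
by apply: qexp_eq (qexp_cons c k la ih) _ => t; rewrite addrA.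
Qed.

Lemma qexp_sum (I : Type) (r : seq I) (P : pred I) (f : I -> R -> R[i]) a :
  (forall i, P i -> qexp a (f i)) -> qexp a (fun t => \sum_(i <- r | P i) f i t).
Proof.
move=> fa; elim: r => [|i r ih].
  by apply: qexp_eq (qexp0 a) _ => t; rewrite big_nil.
have [Pi|/negbTE Pi] := boolP (P i).
  by apply: qexp_eq (qexpD (fa i Pi) ih) _ => t; rewrite big_cons Pi.
by apply: qexp_eq ih _ => t; rewrite big_cons Pi.
Qed.

Lemma qexpM a b f g : qexp a f -> qexp b g -> qexp (a + b) (fun t => f t * g t).
Proof.
move=> fa gb; elim: fa => [|lam c k h la ha ih].
  by apply: qexp_eq (qexp0 _) _ => t; rewrite mul0r.
have hg : qexp (a + b) (fun t => c * (t ^+ k)%:C * cexp (lam * t%:C) * g t).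
  elim: gb => [|lam' c' k' h' la' ha' ih'].
    by apply: qexp_eq (qexp0 _) _ => t; rewrite mulr0.
  have lab : Re (lam + lam') = a + b by rewrite ReD la la'.
  apply: qexp_eq (qexp_cons (c * c') (k + k') lab ih') _ => t.
  by rewrite mulrDr mulrDl cexpD exprD rmorphM; ring.
by apply: qexp_eq (qexpD hg ih) _ => t; rewrite mulrDl.
Qed.

Lemma qexp_cst x : qexp 0 (fun=> x).
Proof.
apply: qexp_eq (@qexp_mono 0 0 x 0 erefl) _ => t.
by rewrite mul0r cexp0 expr0 !mulr1.
Qed.

Lemma qexpZ a x f : qexp a f -> qexp a (fun t => x * f t).
Proof. by move=> fa; have := qexpM (qexp_cst x) fa; rewrite add0r. Qed.

Lemma qexpN a f : qexp a f -> qexp a (fun t => - f t).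
Proof. by move=> /(qexpZ (-1)) fa; apply: qexp_eq fa _ => t; rewrite mulN1r. Qed.

Lemma qexp_prod (m : nat) (a : 'I_m -> R) (f : 'I_m -> R -> R[i]) :
  (forall l, qexp (a l) (f l)) ->
  qexp (\sum_(l < m) a l) (fun t => \prod_(l < m) f l t).
Proof.
elim: m a f => [|m ih] a f fa.
  by rewrite big_ord0; apply: qexp_eq (qexp_cst 1) _ => t; rewrite big_ord0.
rewrite big_ord_recl.
apply: qexp_eq (qexpM (fa ord0) (ih _ _ (fun l => fa (lift ord0 l)))) _ => t.
by rewrite big_ord_recl.
Qed.

(** Each factor [t] is paid for with half of the remaining rate, since
    [b / 2 * t <= expR (b / 2 * t)]. *)
Lemma pow_le_expR (k : nat) b : 0 < b ->
  exists2 C : R, 0 < C & forall t, 0 <= t -> t ^+ k <= C * expR (b * t).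
Proof.
elim: k b => [|k ih] b b0.
  by exists 1 => // t t0; rewrite expr0 mul1r -expR0 ler_expR mulr_ge0 // ltW.
have b20 : 0 < b / 2 by rewrite divr_gt0.
have [C C0 h] := ih _ b20; exists (C * (b / 2)^-1).
  by rewrite mulr_gt0 // invr_gt0.
move=> t t0; rewrite exprSr.
have tle : t <= (b / 2)^-1 * expR (b / 2 * t).
  rewrite mulrC ler_pdivlMr // mulrC.
  by apply: le_trans (expR_ge1Dx _); rewrite lerDr.
have -> : C * (b / 2)^-1 * expR (b * t) =
    C * expR (b / 2 * t) * ((b / 2)^-1 * expR (b / 2 * t)).
  have -> : b * t = b / 2 * t + b / 2 * t by field.
  by rewrite expRD; ring.
by apply: ler_pM; rewrite ?exprn_ge0 ?h.
Qed.

Lemma qexp_expO a b f : b < a -> qexp (- a) f -> expO f b.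
Proof.
move=> ba; elim => [|lam c k g la ga ih]; first exact: expO0.
apply: expOD ih.
have pk : expO (fun t : R => (t ^+ k)%:C) (b - a).
  have ab : 0 < a - b by rewrite subr_gt0.
  have [C C0 h] := pow_le_expR k ab.
  exists 0, C => t t0; rewrite normc_real ger0_norm ?exprn_ge0 //.
  by apply: le_trans (h t t0) _; rewrite opprB.
have := expOM (expOZ c pk) (expO_cexp lam).
by rewrite la opprK subrK.
Qed.

(** If [alp = - lam], the forcing resonates with the homogeneous solution and the degree in [t]
    rises by one. Otherwise the leading term is divided by [alp + lam], and the derivative of its
    power leaves a forcing of degree one less, treated by induction. *)
Lemma qexp_solve_mono a lam c k alp : Re alp = a ->
  exists2 p, qexp a p & forall t,
    cderive p t (- lam * p t + c * (t ^+ k)%:C * cexp (alp * t%:C)).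
Proof.
move=> alpa; have [lam0|nz] := eqVneq (alp + lam) 0.
  exists (fun t => c / k.+1%:R * (t ^+ k.+1)%:C * cexp (alp * t%:C)).
    exact: qexp_mono.
  move=> t.
  apply: cderive_eq (cderiveM (cderiveZ (c / k.+1%:R) (cderive_pow k.+1 t))
    (cderive_cexp alp t)) _.
  have -> : lam = - alp by apply/eqP; rewrite -addr_eq0 addrC lam0.
  have k0 : (k.+1%:R : R[i]) != 0 by rewrite pnatr_eq0.
  by rewrite rmorphM /= rmorph_nat; field.
elim: k c => [|k ih] c.
  exists (fun t => c / (alp + lam) * (t ^+ 0)%:C * cexp (alp * t%:C)).
    exact: qexp_mono.
  move=> t.
  apply: cderive_eq (cderiveM (cderiveZ (c / (alp + lam)) (cderive_pow 0 t))
    (cderive_cexp alp t)) _.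
  by rewrite mul0r expr0; field.
have [p pa dp] := ih (- (c * k.+1%:R / (alp + lam))).
exists (fun t => c / (alp + lam) * (t ^+ k.+1)%:C * cexp (alp * t%:C) + p t).
  exact: qexp_cons.
move=> t.
apply: cderive_eq (cderiveD (cderiveM (cderiveZ (c / (alp + lam))
  (cderive_pow k.+1 t)) (cderive_cexp alp t)) (dp t)) _.
by rewrite rmorphM /= rmorph_nat; field.
Qed.

Lemma qexp_solve a lam h : qexp a h ->
  exists2 p, qexp a p & forall t, cderive p t (- lam * p t + h t).
Proof.
elim => [|alp c k g la ga [p pa dp]].
  exists (fun=> 0); first exact: qexp0.
  by move=> t; apply: cderive_eq (cderive_cst _ t) _; rewrite mulr0 addr0.
have [q qa dq] := qexp_solve_mono lam c k la.
exists (fun t => q t + p t); first exact: qexpD.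
by move=> t; apply: cderive_eq (cderiveD (dq t) (dp t)) _; ring.
Qed.

End Quasipolynomials.

(** * The class [FE] and its description by coordinates *)

Section FunctionClass.
Variable R : realType.

Lemma polynomial_fun0 (X : lmodType R[i]) : polynomial_fun (fun=> 0 : X).
Proof. by exists 0%N, (fun=> 0) => t; rewrite big_ord0. Qed.

Lemma polynomial_fun_mono (X : lmodType R[i]) k (x : X) :
  polynomial_fun (fun t : R => (t ^+ k)%:C *: x).
Proof.
exists k.+1, (fun j => if j == k then x else 0) => t.
rewrite big_ord_recr /= eqxx big1 ?add0r // => j _.
by rewrite ltn_eqF // scaler0.
Qed.

Lemma polynomial_funD (X : lmodType R[i]) (p q : R -> X) :
  polynomial_fun p -> polynomial_fun q -> polynomial_fun (fun t => p t + q t).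
Proof.
move=> [d [a pE]] [e [b qE]].
exists (maxn d e), (fun k => (if (k < d)%N then a k else 0) +
                             (if (k < e)%N then b k else 0)) => t.
have ext (c : nat -> X) n : (n <= maxn d e)%N ->
    \sum_(k < n) (t ^+ k)%:C *: c k =
    \sum_(k < maxn d e) (t ^+ k)%:C *: (if (k < n)%N then c k else 0).
  move=> nle; rewrite (big_ord_widen _ (fun k => (t ^+ k)%:C *: c k) nle) big_mkcond /=.
  by apply: eq_bigr => k _; case: ifP; rewrite ?scaler0.
rewrite pE qE (ext a d) ?leq_maxl // (ext b e) ?leq_maxr // -big_split /=.
by apply: eq_bigr => k _; rewrite scalerDr.
Qed.

Lemma FE0 (X : lmodType R[i]) (a : R) : FE a (fun=> 0 : X).
Proof.
by exists [::], (fun _ _ => 0); split => // t; rewrite big_nil.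
Qed.

Lemma FE_mono (X : lmodType R[i]) (a : R) lam k (x : X) : complex.Re lam = a ->
  FE a (fun t : R => (cexp (lam * t%:C) * (t ^+ k)%:C) *: x).
Proof.
move=> la; exists [:: lam], (fun _ t => (t ^+ k)%:C *: x); split => //.
- by move=> b; rewrite inE => /eqP ->.
- by move=> b _; exact: polynomial_fun_mono.
- by move=> t; rewrite big_seq1 scalerA.
Qed.

Lemma FED (X : lmodType R[i]) (a : R) (f g : R -> X) :
  FE a f -> FE a g -> FE a (fun t => f t + g t).
Proof.
move=> [S [p [uS reS polS fE]]] [S' [p' [uS' reS' polS' gE]]].
(* Each polynomial is extended by zero off its own list of exponents, so that both sums can run over
   the duplicate-free union, as [FE] demands distinct exponents. *)
pose q (T : seq R[i]) (r : R[i] -> R -> X) lam t := if lam \in T then r lam t else 0.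
have qE (T U : seq R[i]) r t : uniq T -> uniq U -> {subset T <= U} ->
    \sum_(lam <- T) cexp (lam * t%:C) *: r lam t =
    \sum_(lam <- U) cexp (lam * t%:C) *: q T r lam t.
  move=> uT uU TU; rewrite [RHS](bigID (mem T)) /= [X in _ + X]big1 ?addr0; last first.
    by move=> lam /negbTE lamT; rewrite /q lamT scaler0.
  rewrite -[RHS]big_filter; have pT : perm_eq T [seq i <- U | i \in T].
    apply: uniq_perm => //; first exact: filter_uniq.
    move=> z; rewrite mem_filter; case zT: (z \in T) => //=.
    by rewrite TU.
  by rewrite (perm_big _ pT) !big_filter; apply: eq_bigr => lam lamT; rewrite /q lamT.
exists (undup (S ++ S')), (fun lam t => q S p lam t + q S' p' lam t); split.
- exact: undup_uniq.
- by move=> lam; rewrite mem_undup mem_cat => /orP[/reS|/reS'].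
- move=> lam _; apply: polynomial_funD; rewrite /q.
    by have := polS lam; case: (lam \in S) => [/(_ isT)//|_]; exact: polynomial_fun0.
  by have := polS' lam; case: (lam \in S') => [/(_ isT)//|_]; exact: polynomial_fun0.
- move=> t; rewrite fE gE (qE S (undup (S ++ S'))) ?undup_uniq //; last first.
    by move=> z zS; rewrite mem_undup mem_cat zS.
  rewrite (qE S' (undup (S ++ S'))) ?undup_uniq //; last first.
    by move=> z zS; rewrite mem_undup mem_cat zS orbT.
  by rewrite -big_split /=; apply: eq_bigr => lam _; rewrite scalerDr.
Qed.

Lemma col_delta_sum n (x : 'cV[R[i]]_n) : x = \sum_i x i 0 *: delta_mx i 0.
Proof.
apply/colP => i; rewrite summxE (bigD1 i) //= big1 ?addr0.
  by rewrite !mxE !eqxx mulr1.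
by move=> j /negbTE ji; rewrite !mxE eq_sym ji mulr0.
Qed.

(** [qexp] allows repeated exponents where [FE] does not; the equivalence lets sums, products and
    linear equations be treated by induction on terms. *)
Lemma FE_qexp n (a : R) (f : R -> 'cV[R[i]]_n) :
  FE a f <-> forall i, qexp a (fun t => f t i 0).
Proof.
split.
  move=> [S [p [uS reS polS fE]]] i.
  apply: (@qexp_eq _ _ (fun t => \sum_(lam <- S | lam \in S)
      (cexp (lam * t%:C) *: p lam t) i 0)); last first.
    by move=> t; rewrite fE summxE -big_seq.
  apply: qexp_sum => lam lamS; have [d [c pE]] := polS _ lamS.
  apply: (@qexp_eq _ _ (fun t => \sum_(k < d)
      (c k i 0 * (t ^+ k)%:C * cexp (lam * t%:C)))).
    by apply: qexp_sum => k _; exact/qexp_mono/reS.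
  move=> t; rewrite mxE pE summxE mulr_sumr; apply: eq_bigr => k _.
  by rewrite mxE; ring.
move=> fa.
have FEi i h : qexp a h -> FE a (fun t => h t *: (delta_mx i 0 : 'cV[R[i]]_n)).
  elim => [|lam c k g la ga ih].
    by rewrite (_ : (fun t => _) = (fun=> 0)); [exact: FE0|apply/funext => t; rewrite scale0r].
  rewrite (_ : (fun t => _) = (fun t => (cexp (lam * t%:C) * (t ^+ k)%:C) *:
      (c *: delta_mx i 0) + g t *: (delta_mx i 0 : 'cV[R[i]]_n))).
    exact/FED/ih/FE_mono.
  by apply/funext => t; rewrite scalerDl scalerA; congr (_ *: _ + _); ring.
have FEsum (r : seq 'I_n) : FE a (fun t =>
    \sum_(i <- r) f t i 0 *: (delta_mx i 0 : 'cV[R[i]]_n)).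
  elim: r => [|i r ih].
    by rewrite (_ : (fun t => _) = (fun=> 0)); [exact: FE0|apply/funext => t; rewrite big_nil].
  rewrite (_ : (fun t => _) = (fun t => f t i 0 *: (delta_mx i 0 : 'cV[R[i]]_n) +
      \sum_(j <- r) f t j 0 *: (delta_mx j 0 : 'cV[R[i]]_n))); first exact/FED/ih/FEi/fa.
  by apply/funext => t; rewrite big_cons.
rewrite (_ : f = (fun t => \sum_i f t i 0 *: (delta_mx i 0 : 'cV[R[i]]_n))) //.
by apply/funext => t; exact: col_delta_sum.
Qed.

End FunctionClass.

(** * Scalar linear equations with an exponentially small error *)

Section ScalarODE.
Variable R : realType.
Implicit Types (a b r s t T C : R).

Lemma derive_le0_nincr (f df : R -> R) T :
  (forall t, T <= t -> is_derive t 1 f (df t)) ->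
  (forall t, T <= t -> df t <= 0) ->
  forall s t, T <= s -> s <= t -> f t <= f s.
Proof.
move=> fd df0 s t Ts; rewrite le_eqVlt => /predU1P[->//|st].
have fst x : x \in `]s, t[ -> is_derive x 1 f (df x).
  by rewrite in_itv /= => /andP[sx _]; apply: fd; rewrite (le_trans Ts) // ltW.
have fct : {within `[s, t], continuous f}.
  apply: derivable_within_continuous => x; rewrite in_itv /= => /andP[sx _].
  exact: (@ex_derive _ _ _ _ _ _ _ (fd x (le_trans Ts sx))).
have [c] := MVT st fst fct; rewrite in_itv /= => /andP[sc _] E.
by rewrite -subr_le0 E mulr_le0_ge0 ?subr_ge0 ?(ltW st) // df0 // (le_trans Ts) // ltW.
Qed.

(* Integral-free form of [`|w t - w s| <= \int `|dw|]. *)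
Lemma monotone_envelopes (w dw : R -> R) T C a : a != 0 ->
  (forall t, T <= t -> is_derive t 1 w (dw t)) ->
  (forall t, T <= t -> `|dw t| <= C * expR (- a * t)) ->
  forall s t, T <= s -> s <= t ->
    w t + C / a * expR (- a * t) <= w s + C / a * expR (- a * s) /\
    w s - C / a * expR (- a * s) <= w t - C / a * expR (- a * t).
Proof.
move=> a0 dwt wb s t Ts st.
(* The correction differentiates to minus the bound whatever the sign of [a], so one statement
   serves both decay and growth. *)
have dE (x : R) : is_derive x 1 (fun t => C / a * expR (- a * t)) (- (C * expR (- a * x))).
  apply: (is_derive_eq (is_deriveZ (C / a) (is_derive_expRM (- a) x))).
  by rewrite /GRing.scale /=; field.
split.
  apply: (@derive_le0_nincr (w + (fun t => C / a * expR (- a * t)))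
    (fun t => dw t - C * expR (- a * t)) T) => // x Tx.
    exact: (is_deriveD (dwt x Tx) (dE x)).
  by have := wb x Tx; rewrite ler_norml => /andP[_]; rewrite subr_le0.
rewrite -lerN2.
apply: (@derive_le0_nincr (- (w - (fun t => C / a * expR (- a * t))))
    (fun t => - (dw t + C * expR (- a * t))) T) => // x Tx.
  apply: (is_derive_eq (is_deriveN (is_deriveB (dwt x Tx) (dE x)))).
  by rewrite opprK.
by have := wb x Tx; rewrite ler_norml => /andP[]; lra.
Qed.

(** The limit is the infimum of the upper envelope [w + E]. Every value of the lower envelope
    [w - E] lies below every value of the upper one, so at each time the infimum is squeezed between
    the two. *)
Lemma real_limit (w dw : R -> R) T C a : 0 < a ->
  (forall t, T <= t -> is_derive t 1 w (dw t)) ->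
  (forall t, T <= t -> `|dw t| <= C * expR (- a * t)) ->
  exists c, forall t, T <= t -> `|w t - c| <= C / a * expR (- a * t).
Proof.
move=> a0 dwt wb.
have C0 : 0 <= C.
  have := le_trans (normr_ge0 _) (wb T (lexx _)).
  by rewrite pmulr_lge0 ?expR_gt0.
have mon := monotone_envelopes (lt0r_neq0 a0) dwt wb.
set E := fun t => C / a * expR (- a * t).
have E0 t : 0 <= E t by rewrite mulr_ge0 ?expR_ge0 ?divr_ge0 // ltW.
have cross s t : T <= s -> T <= t -> w s - E s <= w t + E t.
  move=> Ts Tt; case/orP: (le_total s t) => st.
    by have [_ h] := mon s t Ts st; have := E0 t; rewrite /E in h *; lra.
  by have [h _] := mon t s Tt st; have := E0 s; rewrite /E in h *; lra.
set A := [set w t + E t | t in [set t | T <= t]].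
have Anonempty : A !=set0 by exists (w T + E T), T => //=.
have lbA s : T <= s -> lbound A (w s - E s).
  by move=> Ts _ [t /= Tt <-]; exact: cross.
exists (inf A) => t Tt.
have infle : inf A <= w t + E t.
  by apply: ge_inf; [exists (w t - E t); exact: lbA | exists t].
have leinf := lb_le_inf Anonempty (lbA t Tt).
by rewrite ler_distl -/(E t); apply/andP; split; lra.
Qed.

Lemma real_growth (w dw : R -> R) T C a : a < 0 -> 0 <= T ->
  (forall t, T <= t -> is_derive t 1 w (dw t)) ->
  (forall t, T <= t -> `|dw t| <= C * expR (- a * t)) ->
  exists C', forall t, T <= t -> `|w t| <= C' * expR (- a * t).
Proof.
move=> a0 T0 dwt wb; have mon := monotone_envelopes (ltr0_neq0 a0) dwt wb.
set E := fun t => C / a * expR (- a * t).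
exists (`|w T| + `|E T| + `|C / a|) => t Tt.
(* As [a < 0] and [0 <= T <= t], the values at [T] can be absorbed into the constant. *)
have e1 : 1 <= expR (- a * t).
  by rewrite -expR0 ler_expR mulr_ge0 ?oppr_ge0 ?(ltW a0) // (le_trans T0).
have : `|w t| <= `|w T| + `|E T| + `|E t|.
  have [h1 h2] := mon T t (lexx _) Tt.
  have := ler_norm (w T).
  have := ler_norm (E T); have := ler_norm (E t); rewrite -/(E T) -/(E t) in h1 h2 *.
  have := ler_norm (- w T); have := ler_norm (- E T); have := ler_norm (- E t).
  by rewrite !normrN ler_norml => *; apply/andP; split; lra.
move=> /le_trans; apply; rewrite mulrDl; apply: lerD.
  by rewrite ler_peMr // addr_ge0.
by rewrite /E normrM [X in _ * X]ger0_norm ?expR_ge0.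
Qed.

Lemma expO_limit (w dw : R -> R[i]) T a : 0 < a ->
  (forall t, T < t -> cderive w t (dw t)) -> expO dw a ->
  exists c, expO (fun t => w t - c) a.
Proof.
move=> a0 dwt [T' [C h]]; pose S := Num.max (T + 1) T'.
have ST t : S <= t -> T < t by rewrite /S ge_max => /andP[? _]; lra.
have ST' t : S <= t -> T' <= t by rewrite /S ge_max => /andP[].
have [c1 h1] := real_limit a0 (fun t St => (dwt t (ST t St)).1)
  (fun t St => le_trans (Re_le_normc _) (h t (ST' t St))).
have [c2 h2] := real_limit a0 (fun t St => (dwt t (ST t St)).2)
  (fun t St => le_trans (Im_le_normc _) (h t (ST' t St))).
exists (c1 +i* c2), S, (C / a + C / a) => t St.
apply: le_trans (normc_le _) _; rewrite ReD ImD ReN ImN mulrDl.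
by apply: lerD; [exact: h1 | exact: h2].
Qed.

Lemma expO_growth (w dw : R -> R[i]) T a : a < 0 ->
  (forall t, T < t -> cderive w t (dw t)) -> expO dw a -> expO w a.
Proof.
move=> a0 dwt [T' [C h]]; pose S := Num.max 0 (Num.max (T + 1) T').
have S0 : 0 <= S by rewrite /S le_max lexx.
have ST t : S <= t -> T < t by rewrite /S !ge_max => /and3P[_ ? _]; lra.
have ST' t : S <= t -> T' <= t by rewrite /S !ge_max => /and3P[].
have [C1 h1] := real_growth a0 S0 (fun t St => (dwt t (ST t St)).1)
  (fun t St => le_trans (Re_le_normc _) (h t (ST' t St))).
have [C2 h2] := real_growth a0 S0 (fun t St => (dwt t (ST t St)).2)
  (fun t St => le_trans (Im_le_normc _) (h t (ST' t St))).
exists S, (C1 + C2) => t St.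
apply: le_trans (normc_le _) _; rewrite mulrDl.
by apply: lerD; [exact: h1 | exact: h2].
Qed.

Lemma expO_cst_eq0 (c : R[i]) a : 0 < a -> expO (fun=> c) a -> c = 0.
Proof.
move=> a0 /expO_bound[T [C [T0 C0 h]]].
apply: ComplexField.Normc.eq0_normc; apply/eqP; rewrite eq_le normc_ge0 andbT leNgt.
(* At this time [C <= normc c * (a * t)], while [1 + a * t <= expR (a * t)] turns the assumed bound
   into [normc c * (1 + a * t) <= C]. *)
apply/negP => c0; pose t := Num.max T (C / (a * normc c)).
have Tt : T <= t by rewrite /t le_max lexx.
have t0 : 0 < t by rewrite (lt_le_trans T0).
have ct : C <= normc c * (a * t).
  have : C / (a * normc c) <= t by rewrite /t le_max lexx orbT.
  by rewrite ler_pdivrMr ?mulr_gt0 //; lra.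
have := h t Tt; rewrite mulNr expRN ler_pdivlMr ?expR_gt0 // => hc.
have := expR_ge1Dx (a * t); rewrite -(ler_pM2l c0) mulrDr mulr1; lra.
Qed.

Lemma scalar_asymptotics (lam : R[i]) (m e nu T : R) (z h r : R -> R[i]) :
  (forall t, T < t -> cderive z t (- lam * z t + h t + r t)) ->
  qexp (- m) h -> 0 < e -> expO r (m + e) -> nu < m -> expO z nu ->
  Re lam < nu \/ m <= Re lam ->
  exists p e', [/\ 0 < e', qexp (- m) p,
    forall t, cderive p t (- lam * p t + h t) & expO (fun t => z t - p t) (m + e')].
Proof.
move=> dz hm e0 rO num zO lamP.
have [q qm dq] := qexp_solve lam hm.
(* With this integrating factor only the error survives in the derivative: [w' = exp (lam t) r]. *)
pose w t := cexp (lam * t%:C) * (z t - q t).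
have dw t : T < t -> cderive w t (cexp (lam * t%:C) * r t).
  move=> Tt; apply: cderive_eq (cderiveM (cderive_cexp lam t)
    (cderiveB (dz t Tt) (dq t))) _; ring.
have dwO e' : e' <= e ->
    expO (fun t => cexp (lam * t%:C) * r t) (m + e' - Re lam).
  move=> e'e; apply: expO_le (expOM (expO_cexp lam) rO); lra.
have wE t : z t - q t = cexp (- lam * t%:C) * w t.
  by rewrite /w mulrA [_ * cexp _]mulrC cexpMN mul1r.
have back e' u : expO u (m + e' - Re lam) ->
    expO (fun t => cexp (- lam * t%:C) * u t) (m + e').
  move=> uO; apply: expO_le (expOM (expO_cexp (- lam)) uO).
  by rewrite ReN; lra.
have [ltm|lem] := ltP m (Re lam).
  (* Shrinking [e] to half the gap makes the rate [m + e' - Re lam] negative, so the growth lemma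
     applies and no constant has to be chosen. *)
  pose e' := Num.min e ((Re lam - m) / 2).
  have e'0 : 0 < e' by rewrite /e' lt_min e0 /= divr_gt0 // subr_gt0.
  have [e'e e'l] : e' <= e /\ e' <= (Re lam - m) / 2.
    by split; rewrite /e' ge_min lexx ?orbT.
  exists q, e'; split => //.
  have wO : expO w (m + e' - Re lam) by apply: expO_growth dw (dwO _ e'e); lra.
  by apply: expO_eq (back _ _ wO) _ => t; rewrite wE.
have a0 : 0 < m + e - Re lam by lra.
have [c cO] := expO_limit a0 dw (dwO e (lexx _)).
exists (fun t => q t + c * cexp (- lam * t%:C)), e; split => //.
(* Here [Re lam <= m]. Either [Re lam = m] and the free term belongs to the class, or [Re lam < nu];
   then [w] itself decays, since both [z] and [q] have rate [nu], and its limit [c] is zero. *)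
- apply: qexpD => //; case: lamP => lamP; last first.
    have -> : (fun t => c * cexp (- lam * t%:C)) =
        (fun t => c * (t ^+ 0)%:C * cexp (- lam * t%:C)).
      by apply/funext => t; rewrite expr0 mulr1.
    by apply: qexp_mono; rewrite ReN; congr (- _); apply/eqP; rewrite eq_le lem lamP.
  have -> : c = 0.
    have wO : expO w (nu - Re lam).
      apply: expO_le (expOM (expO_cexp lam) (expOB zO (qexp_expO num qm))); lra.
    apply: (@expO_cst_eq0 _ (Num.min (m + e - Re lam) (nu - Re lam))).
      by rewrite lt_min a0 subr_gt0.
    have cO' := expOB (expO_le _ wO) (expO_le _ cO).
    apply: expO_eq (cO' (Num.min (m + e - Re lam) (nu - Re lam)) _ _) _.
    + by rewrite ge_min lexx orbT.
    + by rewrite ge_min lexx.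
    + by move=> t; ring.
  by apply: qexp_eq (qexp0 _) _ => t; rewrite mul0r.
- move=> t; apply: cderive_eq (cderiveD (dq t) (cderiveZ c (cderive_cexp (- lam) t))) _.
  ring.
- apply: expO_eq (back _ _ cO) _ => t; rewrite opprD addrA wE; ring.
Qed.

End ScalarODE.

(** * Linear systems by triangularization *)

Section LinearSystems.
Variable R : realType.
Implicit Types (m e nu T a : R).

(** The Schur form is lower triangular, so its diagonal entries are roots of its characteristic
    polynomial. Eigenvectors are row vectors here: one for the conjugate, multiplied on the right by
    [P], is one for [A]. *)
Lemma trigonalization n (A : 'M[R[i]]_n) : (0 < n)%N ->
  exists P : 'M[R[i]]_n, [/\ P \in unitmx, is_trig_mx (P *m A *m invmx P) &
    forall i, eigenvalue A ((P *m A *m invmx P) i i)].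
Proof.
move=> n0; have [P Pu trig] := Schur A n0.
have Punit := unitarymx_unit Pu.
move: trig; rewrite /similar_to conjumx // => trig.
exists P; split => // i.
have : eigenvalue (P *m A *m invmx P) ((P *m A *m invmx P) i i).
  rewrite eigenvalue_root_char char_poly_trig //.
  by rewrite /root horner_prod (bigD1 i) //= hornerXsubC subrr mul0r.
move=> /eigenvalueP[v vE v0]; apply/eigenvalueP; exists (v *m P).
  by rewrite scalemxAl -vE !mulmxA mulmxKV.
apply: contra_neq v0 => vP0.
by rewrite -(mulmxK Punit v) vP0 mul0mx.
Qed.

(** Row [i] contains only coordinates [j <= i], so these are solved in increasing order: the [p j]
    already found join the forcing, the differences [z j - p j] join the error, and the scalar
    result applies with the smaller of the available gains. *)
Lemma triangular_asymptotics n (A : 'M[R[i]]_n) m e nu T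
    (z h r : 'I_n -> R -> R[i]) : is_trig_mx A ->
  (forall i t, T < t ->
     cderive (z i) t (- (\sum_j A i j * z j t) + h i t + r i t)) ->
  (forall i, qexp (- m) (h i)) -> 0 < e -> (forall i, expO (r i) (m + e)) ->
  nu < m -> (forall i, expO (z i) nu) ->
  (forall i, Re (A i i) < nu \/ m <= Re (A i i)) ->
  exists p e', [/\ 0 < e', forall i, qexp (- m) (p i),
    forall i t, cderive (p i) t (- (\sum_j A i j * p j t) + h i t) &
    forall i, expO (fun t => z i t - p i t) (m + e')].
Proof.
move=> /is_trig_mxP trig dz hm e0 rO num zO AP.
suff /(_ n (leqnn n)) [p [e' [e'0 pP]]] : forall k, (k <= n)%N ->
    exists (p : 'I_n -> R -> R[i]) e', 0 < e' /\ forall i : 'I_n, (i < k)%N ->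
    [/\ qexp (- m) (p i), forall t, cderive (p i) t (- (\sum_j A i j * p j t) + h i t) &
     expO (fun t => z i t - p i t) (m + e')].
  by exists p, e'; split => // i; have [] := pP i (ltn_ord i).
elim=> [|k ih] kn; first by exists (fun _ _ => 0), 1; split.
have [p [e1 [e10 pP]]] := ih (ltnW kn).
pose i := Ordinal kn.
have sumE (w : 'I_n -> R[i]) :
    \sum_j A i j * w j = A i i * w i + \sum_(j : 'I_n | (j < i)%N) A i j * w j.
  rewrite (bigD1 i) //=; congr (_ + _).
  rewrite big_mkcond [RHS]big_mkcond; apply: eq_bigr => j _ /=.
  have [ji|ij|ji] := ltngtP j i.
  - by case: eqP => // E; rewrite E ltnn in ji.
  - by rewrite trig // mul0r; case: ifP.
  - by have -> : j = i by [exact: val_inj]; rewrite eqxx.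
pose e2 := Num.min e e1.
have e20 : 0 < e2 by rewrite lt_min e0.
have [e2e e2e1] : e2 <= e /\ e2 <= e1 by rewrite !ge_min !lexx orbT.
pose h' t := h i t - \sum_(j : 'I_n | (j < i)%N) A i j * p j t.
pose r' t := r i t - \sum_(j : 'I_n | (j < i)%N) A i j * (z j t - p j t).
have dzi t : T < t -> cderive (z i) t (- A i i * z i t + h' t + r' t).
  move=> Tt; apply: cderive_eq (dz i t Tt) _; rewrite sumE /h' /r'.
  have -> : \sum_(j : 'I_n | (j < i)%N) A i j * (z j t - p j t) =
      \sum_(j : 'I_n | (j < i)%N) A i j * z j t - \sum_(j : 'I_n | (j < i)%N) A i j * p j t.
    by rewrite -sumrB; apply: eq_bigr => j _; rewrite mulrBr.
  ring.
have hm' : qexp (- m) h'.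
  apply: qexpD => //; apply/qexpN/qexp_sum => j ji; apply: qexpZ.
  by have [] := pP j ji.
have rO' : expO r' (m + e2).
  apply: expOB; first by apply: expO_le (rO i); rewrite lerD2l.
  apply: expO_sum => j ji; apply: expOZ; have [_ _] := pP j ji.
  by apply: expO_le; rewrite lerD2l.
have [q [e3 [e30 qm dq qO]]] := scalar_asymptotics dzi hm' e20 rO' num (zO i) (AP i).
(* Redefining coordinate [i] does not disturb the earlier rows: their entries in column [i] lie
   above the diagonal and vanish. *)
pose p' j := if j == i then q else p j.
have p'i : p' i = q by rewrite /p' eqxx.
have p'lt (j : 'I_n) : (j < i)%N -> p' j = p j.
  by move=> ji; rewrite /p' ifF //; apply/eqP => E; rewrite E ltnn in ji.
exists p', (Num.min e1 e3); split; first by rewrite lt_min e10.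
move=> j; rewrite ltnS leq_eqVlt => /predU1P[jk|jk].
  have -> : j = i by exact: val_inj.
  rewrite p'i; split => //.
    move=> t; apply: cderive_eq (dq t) _; rewrite sumE p'i /h'.
    have -> : \sum_(j : 'I_n | (j < i)%N) A i j * p' j t =
        \sum_(j : 'I_n | (j < i)%N) A i j * p j t.
      by apply: eq_bigr => l li; rewrite p'lt.
    ring.
  by apply: expO_le qO; rewrite lerD2l ge_min lexx orbT.
have [pm dp pO] := pP j jk.
rewrite p'lt //; split => //.
  move=> t; apply: cderive_eq (dp t) _; congr (- _ + _); apply: eq_bigr => l _.
  by rewrite /p'; case: eqP => // ->; rewrite trig // !mul0r.
by apply: expO_le pO; rewrite lerD2l ge_min lexx.
Qed.

(** Coordinatewise, so that scalar bounds apply directly; [vexpO_bigO] gives the agreement with the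
    Euclidean norm. *)
Definition vexpO n (u : R -> 'cV[R[i]]_n) a : Prop :=
  forall i, expO (fun t => u t i 0) a.

Lemma is_vderive_mulmx n (P : 'M[R[i]]_n) (u : R -> 'cV[R[i]]_n) t d :
  is_vderive u t d -> is_vderive (fun s => P *m u s) t (P *m d).
Proof.
move=> ud i; rewrite -/(cderive (fun s => (P *m u s) i 0) t ((P *m d) i 0)).
have -> : (fun s => (P *m u s) i 0) = (fun s => \sum_j P i j * u s j 0).
  by apply/funext => s; rewrite mxE.
by rewrite mxE; apply: cderive_sum => j; exact/cderiveZ/ud.
Qed.

Lemma vexpO_mulmx n (P : 'M[R[i]]_n) (u : R -> 'cV[R[i]]_n) a :
  vexpO u a -> vexpO (fun s => P *m u s) a.
Proof.
move=> uO i; have : expO (fun s => \sum_j P i j * u s j 0) a.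
  by apply: expO_sum => j _; exact/expOZ/uO.
by move=> /expO_eq; apply => t; rewrite mxE.
Qed.

Lemma FE_mulmx n (P : 'M[R[i]]_n) (u : R -> 'cV[R[i]]_n) a :
  FE a u -> FE a (fun s => P *m u s).
Proof.
move=> /FE_qexp ua; apply/FE_qexp => i.
have : qexp a (fun s => \sum_j P i j * u s j 0).
  by apply: qexp_sum => j _; exact/qexpZ/ua.
by move=> /qexp_eq; apply => t; rewrite mxE.
Qed.

Lemma linear_asymptotics n (A : 'M[R[i]]_n) m e nu T
    (u h r : R -> 'cV[R[i]]_n) : (0 < n)%N ->
  (forall t, T < t -> is_vderive u t (- (A *m u t) + h t + r t)) ->
  FE (- m) h -> 0 < e -> vexpO r (m + e) -> nu < m -> vexpO u nu ->
  (forall L, eigenvalue A L -> Re L < nu \/ m <= Re L) ->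
  exists p e', [/\ 0 < e', FE (- m) p,
    forall t, is_vderive p t (- (A *m p t) + h t) &
    vexpO (fun t => u t - p t) (m + e')].
Proof.
move=> n0 du hm e0 rO num uO AP.
have [P [Pu trig eigP]] := trigonalization A n0.
set B := P *m A *m invmx P in trig eigP.
have BP v : B *m (P *m v) = P *m (A *m v) :> 'cV_n by rewrite /B !mulmxA mulmxKV.
pose z i t := (P *m u t) i 0.
pose hz i t := (P *m h t) i 0.
pose rz i t := (P *m r t) i 0.
have dz i t : T < t -> cderive (z i) t (- (\sum_j B i j * z j t) + hz i t + rz i t).
  move=> Tt; apply: cderive_eq (is_vderive_mulmx P (du t Tt) i) _.
  rewrite !mulmxDr mulmxN -BP [in LHS]mxE [in LHS]mxE; congr (_ + _ + _).
  by rewrite !mxE.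
have hzm i : qexp (- m) (hz i) by have /FE_qexp := FE_mulmx P hm; exact.
have [p [e' [e'0 pm dp pO]]] := triangular_asymptotics trig dz hzm e0
  (vexpO_mulmx P rO) num (vexpO_mulmx P uO) (fun i => AP _ (eigP i)).
pose q t : 'cV[R[i]]_n := \col_i p i t.
exists (fun t => invmx P *m q t), e'; split => //.
- by apply: FE_mulmx; apply/FE_qexp => i; apply: qexp_eq (pm i) _ => t; rewrite mxE.
- move=> t.
  have dq : is_vderive q t (- (B *m q t) + P *m h t).
    move=> i; have := dp i t; rewrite /cderive.
    have -> : - (\sum_j B i j * p j t) + hz i t = (- (B *m q t) + P *m h t) i 0.
      rewrite [in RHS]mxE [X in _ = X + _]mxE [X in _ = - X + _]mxE.
      rewrite /hz; congr (_ + _); congr (- _).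
      by apply: eq_bigr => j _; rewrite [(q t) j 0]mxE.
    have -> : p i = (fun s => q s i 0) by apply/funext => s; rewrite mxE.
    by [].
  have := is_vderive_mulmx (invmx P) dq.
  by rewrite mulmxDr mulmxN mulKmx // /B !mulmxA mulVmx // mul1mx.
- have qO : vexpO (fun t => P *m u t - q t) (m + e').
    move=> i; apply: expO_eq (pO i) _ => t.
    by rewrite [RHS]mxE [X in _ = _ + X]mxE [X in _ = _ - X]mxE.
  have := vexpO_mulmx (invmx P) qO.
  by under eq_fun do rewrite mulmxBr mulKmx //.
Qed.

End LinearSystems.

(** * A first decay rate from a Lyapunov function *)

Section ExponentialDecay.
Variable R : realType.
Implicit Types (x y z : R[i]) (a b m : R).

(** The inner product of the real plane, that is the real part of [conj x * y]; its double is the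
    derivative of [normc x ^+ 2] in the direction [y]. *)
Definition redot x y : R := Re x * Re y + Im x * Im y.

Lemma redotDr x y z : redot x (y + z) = redot x y + redot x z.
Proof. by rewrite /redot ReD ImD; ring. Qed.

Lemma redotNr x y : redot x (- y) = - redot x y.
Proof. by rewrite /redot ReN ImN; ring. Qed.

Lemma redotMr x y : redot x (y * x) = Re y * normc x ^+ 2.
Proof. by rewrite /redot ReM ImM normc_sqr; ring. Qed.

Lemma young_redot (eta : R) x y : 0 < eta ->
  2 * redot x y <= eta * normc x ^+ 2 + eta^-1 * normc y ^+ 2.
Proof.
move=> eta0; rewrite !normc_sqr /redot.
have sq (u v : R) : 2 * (u * v) <= eta * u ^+ 2 + eta^-1 * v ^+ 2.
  have : 0 <= eta * (u - eta^-1 * v) ^+ 2 by rewrite mulr_ge0 ?sqr_ge0 // ltW.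
  have -> : eta * (u - eta^-1 * v) ^+ 2 =
      eta * u ^+ 2 + eta^-1 * v ^+ 2 - 2 * (u * v) by field; rewrite gt_eqF.
  by rewrite subr_ge0.
have := sq (Re x) (Re y); have := sq (Im x) (Im y); lra.
Qed.

Lemma normcD_sqr x y : normc (x + y) ^+ 2 <= 2 * normc x ^+ 2 + 2 * normc y ^+ 2.
Proof.
rewrite !normc_sqr ReD ImD.
have := sqr_ge0 (Re x - Re y); have := sqr_ge0 (Im x - Im y); lra.
Qed.

(** A Cauchy-Schwarz bound with a crude constant; what counts is that [B] depends on the
    coefficients and not on [z]. *)
Lemma normc_lincomb_sqr (I : Type) (r : seq I) (P : pred I) (c : I -> R[i]) :
  exists2 B : R, 0 <= B & forall z : I -> R[i],
    normc (\sum_(i <- r | P i) c i * z i) ^+ 2 <=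
    B * \sum_(i <- r | P i) normc (z i) ^+ 2.
Proof.
elim: r => [|i r [B B0 ih]].
  by exists 0 => // z; rewrite !big_nil ComplexField.Normc.normc0 expr0n /= mulr0.
have [Pi|/negbTE Pi] := boolP (P i); last by exists B => // z; rewrite !big_cons Pi.
have nc0 : 0 <= normc (c i) ^+ 2 by rewrite sqr_ge0.
exists (2 * normc (c i) ^+ 2 + 2 * B); first by rewrite addr_ge0 // mulr_ge0.
move=> z; rewrite !big_cons Pi.
apply: le_trans (normcD_sqr _ _) _.
rewrite ComplexField.Normc.normcM exprMn.
have := ih z.
set S := \sum_(j <- r | P j) normc (z j) ^+ 2.
have S0 : 0 <= S by apply: sumr_ge0 => j _; exact: sqr_ge0.
have := mulr_ge0 nc0 S0; have := mulr_ge0 B0 (sqr_ge0 (normc (z i))); lra.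
Qed.

(* The weights are built along the triangular order: multiplying those of the
   earlier coordinates by a large [c] absorbs, by Young's inequality, their coupling
   into the next one. *)
Lemma lyapunov_weights n (A : 'M[R[i]]_n) m : is_trig_mx A ->
  (forall i, m <= Re (A i i)) -> forall b, b < 2 * m ->
  exists (w : 'I_n -> R) (K : R), [/\ forall i, 1 <= w i, 0 <= K &
    forall z g : 'I_n -> R[i],
    \sum_i w i * (2 * redot (z i) (- (\sum_j A i j * z j) + g i)) <=
    - b * \sum_i w i * normc (z i) ^+ 2 + K * \sum_i normc (g i) ^+ 2].
Proof.
move=> /is_trig_mxP trig Am.
suff /(_ n (leqnn n)) H : forall k, (k <= n)%N -> forall b, b < 2 * m ->
    exists (w : 'I_n -> R) (K : R), [/\ forall i, 1 <= w i, 0 <= K &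
    forall z g : 'I_n -> R[i],
    \sum_(i < n | (i < k)%N) w i * (2 * redot (z i) (- (\sum_j A i j * z j) + g i)) <=
    - b * \sum_(i < n | (i < k)%N) w i * normc (z i) ^+ 2 + K * \sum_i normc (g i) ^+ 2].
  move=> b /H[w [K [w1 K0 wK]]]; exists w, K; split => // z g.
  have := wK z g; under eq_bigl do rewrite ltn_ord.
  by under [X in _ <= - b * X + _ -> _]eq_bigl do rewrite ltn_ord.
elim=> [|k ih] kn b bm.
  exists (fun=> 1), 0; split => // z g.
  by rewrite big_pred0 // [X in - b * X]big_pred0 // mulr0 mul0r addr0.
pose i := Ordinal kn.
have sumS (F : 'I_n -> R) : \sum_(j < n | (j < k.+1)%N) F j =
    F i + \sum_(j < n | (j < k)%N) F j.
  rewrite (bigD1 i) //=; congr (_ + _); apply: eq_bigl => j.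
  by rewrite ltnS -val_eqE /= [RHS]ltn_neqAle andbC.
(* Row [i] needs Young's inequality twice, for the coupling [L] and for [g i]; each use costs [eta],
   which together lowers the rate from [2 * m] to [b]. *)
pose eta := (2 * m - b) / 2.
have eta0 : 0 < eta by rewrite divr_gt0 // subr_gt0.
have etaV0 : 0 < eta^-1 by rewrite invr_gt0.
have bm' : (b + 2 * m) / 2 < 2 * m by lra.
have [w [K [w1 K0 wK]]] := ih (ltnW kn) _ bm'.
have [B B0 hB] := normc_lincomb_sqr (index_enum 'I_n)
  (fun j : 'I_n => (j < k)%N) (fun j => A i j).
(* The earlier coordinates decay at rate [(b + 2 * m) / 2 = b + eta]. Their surplus, weighted by
   [c], is [c * eta = eta + B / eta], enough to pay the coupling cost [B / eta]. *)
pose c := 1 + B / eta ^+ 2.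
have c1 : 1 <= c by rewrite lerDl divr_ge0 // exprn_ge0 // ltW.
have c0 : 0 <= c by rewrite (le_trans ler01).
pose w' j := if j == i then 1 else c * w j.
have w'i : w' i = 1 by rewrite /w' eqxx.
have w'lt (j : 'I_n) : (j < k)%N -> w' j = c * w j.
  by move=> jk; rewrite /w' ifF //; apply/eqP => E; rewrite E ltnn in jk.
exists w', (c * K + eta^-1); split.
- move=> j; rewrite /w'; case: ifP => // _.
  by rewrite -[1]mulr1; apply: ler_pM.
- by rewrite addr_ge0 ?mulr_ge0 // ltW.
move=> z g; rewrite !sumS w'i !mul1r.
have sum_c (F : 'I_n -> R) : \sum_(j < n | (j < k)%N) w' j * F j =
    c * \sum_(j < n | (j < k)%N) w j * F j.
  by rewrite mulr_sumr; apply: eq_bigr => j jk; rewrite w'lt // mulrA.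
rewrite !sum_c.
set X := \sum_(j < n | _) w j * (2 * _).
set S := \sum_(j < n | _) w j * _ ^+ 2.
set Gam := \sum_j normc (g j) ^+ 2.
set Z := normc (z i) ^+ 2.
have XS : X <= - ((b + 2 * m) / 2) * S + K * Gam by exact: wK.
pose L := \sum_(j < n | (j < k)%N) A i j * z j.
have SZ : \sum_(j < n | (j < k)%N) normc (z j) ^+ 2 <= S.
  by apply: ler_sum => j _; rewrite ler_peMl // sqr_ge0.
have LS : normc L ^+ 2 <= B * S.
  by apply: le_trans (hB z) _; rewrite ler_wpM2l.
have gG : normc (g i) ^+ 2 <= Gam.
  by rewrite /Gam (bigD1 i) //= lerDl sumr_ge0 // => j _; exact: sqr_ge0.
have rowE : \sum_j A i j * z j = A i i * z i + L.
  rewrite (bigD1 i) //=; congr (_ + _).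
  rewrite /L big_mkcond [RHS]big_mkcond; apply: eq_bigr => j _ /=.
  have [ji|ij|ji] := ltngtP j k.
  - by case: eqP => // E; rewrite E ltnn in ji.
  - by rewrite trig // mul0r; case: ifP.
  - by have -> : j = i by [exact: val_inj]; rewrite eqxx.
have Y1 := young_redot (z i) (- L) eta0.
have Y2 := young_redot (z i) (g i) eta0.
rewrite normcN in Y1.
have Fi : 2 * redot (z i) (- (\sum_j A i j * z j) + g i) <=
    - b * Z + eta^-1 * (B * S + Gam).
  rewrite rowE opprD !redotDr redotNr redotMr -/Z.
  have Z0 : 0 <= Z by exact: sqr_ge0.
  have mZ : m * Z <= Re (A i i) * Z by rewrite ler_wpM2r.
  have l1 : eta^-1 * normc L ^+ 2 <= eta^-1 * (B * S) by rewrite ler_pM2l.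
  have l2 : eta^-1 * normc (g i) ^+ 2 <= eta^-1 * Gam by rewrite ler_pM2l.
  have e2 : eta * Z = m * Z - b / 2 * Z by rewrite /eta; field.
  rewrite -/Z in Y1 Y2; lra.
have cX : c * X <= c * (- ((b + 2 * m) / 2) * S + K * Gam) by rewrite ler_wpM2l.
have S0 : 0 <= S.
  by apply: le_trans SZ; apply: sumr_ge0 => j _; exact: sqr_ge0.
have key : c * (((b + 2 * m) / 2) * S) = c * (b * S) + eta * S + eta^-1 * (B * S).
  have -> : (b + 2 * m) / 2 = b + eta by rewrite /eta; field.
  by rewrite /c; field; rewrite gt_eqF.
have etaS : 0 <= eta * S by rewrite mulr_ge0 // ltW.
lra.
Qed.

Lemma is_derive_normc_sqr (z : R -> R[i]) (t : R) d : cderive z t d ->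
  is_derive t 1 (fun s => normc (z s) ^+ 2) (2 * redot (z t) d).
Proof.
move=> [dr di].
have -> : (fun s => normc (z s) ^+ 2) =
    (fun s => Re (z s)) * (fun s => Re (z s)) + (fun s => Im (z s)) * (fun s => Im (z s)).
  by apply/funext => s; rewrite normc_sqr !expr2.
apply: (is_derive_eq (is_deriveD (is_deriveM dr dr) (is_deriveM di di))).
by rewrite /GRing.scale /= /redot; ring.
Qed.

Definition sqnorm n (u : 'cV[R[i]]_n) : R := \sum_i normc (u i 0) ^+ 2.

Lemma sqnorm_ge0 n (u : 'cV[R[i]]_n) : 0 <= sqnorm u.
Proof. by apply: sumr_ge0 => i _; exact: sqr_ge0. Qed.

Lemma sqnorm_mulmx n (P : 'M[R[i]]_n) :
  exists2 B : R, 0 <= B & forall u : 'cV_n, sqnorm (P *m u) <= B * sqnorm u.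
Proof.
have rowB i := normc_lincomb_sqr (index_enum 'I_n) xpredT (fun j => P i j).
pose b i := sval (cid2 (rowB i)).
have b0 i : 0 <= b i by rewrite /b; case: cid2.
have hb i := let: exist2 _ _ h as x := cid2 (rowB i) return
  (forall z : 'I_n -> R[i], normc (\sum_(j <- index_enum 'I_n | true) P i j * z j) ^+ 2 <=
    sval x * \sum_(j <- index_enum 'I_n | true) normc (z j) ^+ 2) in h.
exists (\sum_i b i); first exact: sumr_ge0.
move=> u; rewrite /sqnorm mulr_suml; apply: ler_sum => i _.
by rewrite mxE; exact: (hb i (fun j => u j 0)).
Qed.

Lemma sqnormD n (u v : 'cV[R[i]]_n) : sqnorm (u + v) <= 2 * sqnorm u + 2 * sqnorm v.
Proof.
rewrite /sqnorm !mulr_sumr -big_split /=; apply: ler_sum => i _.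
by rewrite mxE normcD_sqr.
Qed.

Lemma vexpO_sqnorm n (u : R -> 'cV[R[i]]_n) a : vexpO u a <->
  exists T C : R, forall t, T <= t -> sqnorm (u t) <= C * expR (- (2 * a) * t).
Proof.
have exp2 (C t : R) : C ^+ 2 * expR (- (2 * a) * t) = (C * expR (- a * t)) ^+ 2.
  rewrite exprMn [X in _ = _ * X]expr2 -expRD; congr (_ * expR _); ring.
split=> [uO|[T [C h]] i].
  suff : forall r : seq 'I_n, exists T C : R, forall t, T <= t ->
      \sum_(i <- r) normc (u t i 0) ^+ 2 <= C * expR (- (2 * a) * t) by exact.
  elim=> [|i r [T [C h]]]; first by exists 0, 0 => t _; rewrite big_nil mul0r.
  have [T' [C' h']] := uO i.
  exists (Num.max T T'), (C' ^+ 2 + C) => t; rewrite ge_max => /andP[Tt Tt'].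
  rewrite big_cons mulrDl lerD ?h // exp2 ler_sqr ?nnegrE ?normc_ge0 ?h' //.
  by rewrite (le_trans (normc_ge0 _) (h' t Tt')).
exists T, (Num.sqrt `|C|) => t Tt.
rewrite -ler_sqr ?nnegrE ?normc_ge0 ?mulr_ge0 ?sqrtr_ge0 ?expR_ge0 //.
rewrite -exp2 sqr_sqrtr //; apply: (@le_trans _ _ (C * expR (- (2 * a) * t))).
  apply: le_trans (h t Tt); rewrite /sqnorm (bigD1 i) //= lerDl.
  by apply: sumr_ge0 => j _; exact: sqr_ge0.
by rewrite ler_wpM2r ?expR_ge0 // ler_norm.
Qed.

(** For the weighted square norm [V] of [P y] the Lyapunov inequality is used at rate [b = a + m],
    strictly between [2 a] and [2 m]. The surplus [m - a] over [2 a] absorbs [g = o(y)], while [f],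
    taken at rate [(a + m) / 2], contributes [exp (- (a + m) t)], which is smaller than
    [exp (- 2 a t)]. *)
Lemma exponential_decay n (A : 'M[R[i]]_n) m (T : R)
    (y g f : R -> 'cV[R[i]]_n) : (0 < n)%N ->
  (forall L, eigenvalue A L -> m <= Re L) ->
  (forall t, T < t -> is_vderive y t (- (A *m y t) + g t + f t)) ->
  (forall eta : R, 0 < eta -> exists T', forall t, T' <= t ->
     sqnorm (g t) <= eta * sqnorm (y t)) ->
  (forall a, a < m -> vexpO f a) ->
  forall a, a < m -> vexpO y a.
Proof.
move=> n0 Am dy gy fO a am.
have [P [Pu trig eigP]] := trigonalization A n0.
set D := P *m A *m invmx P in trig eigP.
have DP v : D *m (P *m v) = P *m (A *m v) :> 'cV_n by rewrite /D !mulmxA mulmxKV.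
pose b := a + m; have bm : b < 2 * m by rewrite /b; lra.
have [w [K [w1 K0 wK]]] := lyapunov_weights trig (fun i => Am _ (eigP i)) bm.
have [B B0 hB] := sqnorm_mulmx P.
have [B' B'0 hB'] := sqnorm_mulmx (invmx P).
pose z t := P *m y t.
pose V t := \sum_i w i * normc (z t i 0) ^+ 2.
pose dV t := \sum_i w i * (2 * redot (z t i 0)
  (- (\sum_j D i j * z t j 0) + (P *m (g t + f t)) i 0)).
have Vd t : T < t -> is_derive t 1 V (dV t).
  move=> Tt.
  have -> : V = \sum_i (fun s => w i * normc (z s i 0) ^+ 2).
    by apply/funext => s; rewrite fct_sumE.
  apply: is_derive_sum => i; apply: is_deriveZ; apply: is_derive_normc_sqr.
  apply: cderive_eq (is_vderive_mulmx P (dy t Tt) i) _.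
  rewrite -addrA mulmxDr mulmxN -DP [in LHS]mxE [X in X + _]mxE; congr (- _ + _).
  by rewrite mxE.
have zV t : sqnorm (z t) <= V t.
  by apply: ler_sum => i _; rewrite ler_peMl // sqr_ge0.
have V0 t : 0 <= V t by apply: le_trans (zV t); exact: sqnorm_ge0.
have yV t : sqnorm (y t) <= B' * V t.
  apply: (@le_trans _ _ (B' * sqnorm (z t))); last by rewrite ler_wpM2l.
  by have := hB' (z t); rewrite /z mulKmx.
pose M := K * (B * (2 * B')); have M0 : 0 <= M by rewrite !mulr_ge0.
(* Chosen so that [M * eta <= m - a]; the [+ 1] excludes division by zero. *)
pose eta := (m - a) / (M + 1).
have M10 : 0 < M + 1 by rewrite ltr_wpDl.
have eta0 : 0 < eta by rewrite divr_gt0 // subr_gt0.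
have [T1 gy1] := gy eta eta0.
have a'm : (a + m) / 2 < m by lra.
have /vexpO_sqnorm[T2 [C fC]] := fO _ a'm.
pose C' := K * (B * (2 * C)).
have dVle t : T1 <= t -> T2 <= t ->
    dV t <= - (2 * a) * V t + C' * expR (- (a + m) * t).
  move=> T1t T2t.
  have := wK (fun i => z t i 0) (fun i => (P *m (g t + f t)) i 0).
  rewrite -/(V t) -/(dV t) -/(sqnorm (P *m (g t + f t))) => /le_trans; apply.
  have gf : sqnorm (P *m (g t + f t)) <=
      B * (2 * (eta * (B' * V t)) + 2 * (C * expR (- (a + m) * t))).
    apply: le_trans (hB _) _; rewrite ler_wpM2l //.
    apply: le_trans (sqnormD _ _) _; rewrite lerD // ler_wpM2l //.
      by apply: le_trans (gy1 t T1t) _; rewrite ler_wpM2l // ltW.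
    apply: le_trans (fC t T2t) _; rewrite le_eqVlt; apply/orP; left; apply/eqP.
    by congr (_ * expR _); field.
  have := ler_wpM2l K0 gf.
  have etaM : M * eta * V t <= (m - a) * V t.
    rewrite ler_wpM2r // /eta mulrA ler_pdivrMr //.
    have : 0 <= m - a by rewrite subr_ge0 ltW.
    by lra.
  have -> : K * (B * (2 * (eta * (B' * V t)) + 2 * (C * expR (- (a + m) * t)))) =
      M * eta * V t + C' * expR (- (a + m) * t) by rewrite /M /C'; ring.
  by rewrite /b; lra.
pose T3 := Num.max (T + 1) (Num.max T1 T2).
have T3P t : T3 <= t -> [/\ T < t, T1 <= t & T2 <= t].
  by rewrite /T3 !ge_max => /and3P[? ? ?]; split => //; lra.
have ma0 : m - a != 0 by rewrite subr_eq0 gt_eqF.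
(* The second summand differentiates to minus the forcing bound left after multiplication by
   [exp (2 a t)], so [W] is nonincreasing. *)
pose W t := expR (2 * a * t) * V t + C' / (m - a) * expR (- (m - a) * t).
pose dW t := expR (2 * a * t) * (2 * a * V t + dV t) - C' * expR (- (m - a) * t).
have Wd t : T3 <= t -> is_derive t 1 W (dW t).
  move=> /T3P[Tt _ _].
  apply: (is_derive_eq (is_deriveD (is_deriveM (is_derive_expRM (2 * a) t) (Vd t Tt))
    (is_deriveZ (C' / (m - a)) (is_derive_expRM (- (m - a)) t)))).
  by rewrite /dW /GRing.scale /=; field.
have dW0 t : T3 <= t -> dW t <= 0.
  move=> /T3P[_ T1t T2t]; have := dVle t T1t T2t.
  have eE : expR (- (m - a) * t) = expR (2 * a * t) * expR (- (a + m) * t).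
    by rewrite -expRD; congr expR; ring.
  rewrite /dW eE mulrCA -mulrBr pmulr_rle0 ?expR_gt0 //; lra.
have Wle := derive_le0_nincr Wd dW0.
have zO : vexpO z a.
  apply/vexpO_sqnorm; exists T3, (W T3 + `|C' / (m - a)| * expR (- (m - a) * T3)) => t T3t.
  apply: le_trans (zV t) _; rewrite [- (2 * a) * t]mulNr [expR (- (2 * a * t))]expRN.
  rewrite ler_pdivlMr ?expR_gt0 // mulrC.
  have : W t <= W T3 by apply: Wle.
  have : - (C' / (m - a)) * expR (- (m - a) * t) <=
      `|C' / (m - a)| * expR (- (m - a) * T3).
    have le1 : expR (- (m - a) * t) <= expR (- (m - a) * T3).
      by rewrite ler_expR ler_wnM2l // oppr_le0 subr_ge0 ltW.
    apply: le_trans (ler_norm _) _; rewrite normrM normrN [X in _ * X]ger0_norm ?expR_ge0 //.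
    by rewrite ler_wpM2l.
  rewrite /W; lra.
have := vexpO_mulmx (invmx P) zO.
by under eq_fun do rewrite mulKmx //.
Qed.

End ExponentialDecay.

(** * Multilinear maps applied to families of functions *)

Section Multilinear.
Variables (R : realType) (n : nat).
Local Notation V := 'cV[R[i]]_n.

Definition ord_cons m (x : V) (w : 'I_m -> V) : 'I_m.+1 -> V :=
  fun l => if unlift ord0 l is Some l' then w l' else x.

Lemma multilinear_head m (M : ('I_m.+1 -> V) -> V) w (c : R[i]) (x y : V) :
  multilinear M ->
  M (ord_cons (c *: x + y) w) = c *: M (ord_cons x w) + M (ord_cons y w).
Proof.
move=> Ml; have E z : ord_cons z w = [eta ord_cons 0 w with ord0 |-> z].
  apply/funext => l; rewrite /ord_cons /=.
  by case: unliftP => [j ->|->] //=; rewrite eq_sym (negbTE (neq_lift _ _)).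
by rewrite E Ml -!E.
Qed.

Lemma multilinear_tail m (M : ('I_m.+1 -> V) -> V) x :
  multilinear M -> multilinear (fun w => M (ord_cons x w)).
Proof.
move=> Ml w l c u v.
have E z : ord_cons x [eta w with l |-> z] = [eta ord_cons x w with lift ord0 l |-> z].
  apply/funext => k; rewrite /ord_cons /=.
  by case: unliftP => [j ->|->] //=; rewrite (inj_eq lift_inj).
by rewrite (E (c *: u + v)) (E u) (E v) Ml.
Qed.

Lemma multilinear_head_sum m (M : ('I_m.+1 -> V) -> V) w (I : Type) (r : seq I)
    (c : I -> R[i]) (x : I -> V) : multilinear M ->
  M (ord_cons (\sum_(i <- r) c i *: x i) w) = \sum_(i <- r) c i *: M (ord_cons (x i) w).
Proof.
move=> Ml; elim: r => [|i r ih]; last by rewrite !big_cons multilinear_head // ih.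
(* Multilinearity is stated through [a *: u + v] only; vanishing at a zero argument is extracted
   from [1 *: 0 + 0 = 0]. *)
rewrite !big_nil; have := multilinear_head w 1 0 0 Ml.
rewrite !scale1r addr0 => /eqP; rewrite -{1}[M _]addr0 eq_sym.
by rewrite (can_eq (addKr _)) => /eqP.
Qed.

Lemma multilinear_expand m (M : ('I_m -> V) -> V) (I : finType)
    (c : 'I_m -> I -> R[i]) (x : 'I_m -> I -> V) : multilinear M ->
  M (fun l => \sum_i c l i *: x l i) =
  \sum_(h : {ffun 'I_m -> I}) (\prod_l c l (h l)) *: M (fun l => x l (h l)).
Proof.
elim: m M c x => [|m ih] M c x Ml.
  rewrite (eq_bigr (fun=> M (fun=> 0))); last first.
    move=> h _; rewrite big_ord0 scale1r; congr M; apply/funext; case => //.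
  rewrite sumr_const card_ffun card_ord expn0.
  by congr M; apply/funext; case.
have consE (w : 'I_m.+1 -> V) : w = ord_cons (w ord0) (fun l => w (lift ord0 l)).
  by apply/funext => l; rewrite /ord_cons; case: unliftP => [j ->|->].
rewrite [X in M X]consE multilinear_head_sum //.
have tailE i : M (ord_cons (x ord0 i)
    (fun l => \sum_j c (lift ord0 l) j *: x (lift ord0 l) j)) =
    \sum_(h : {ffun 'I_m -> I}) (\prod_l c (lift ord0 l) (h l)) *:
      M (ord_cons (x ord0 i) (fun l => x (lift ord0 l) (h l))).
  exact: (ih _ (fun l => c (lift ord0 l)) (fun l => x (lift ord0 l))
    (multilinear_tail (x ord0 i) Ml)).
under eq_bigr => i _ do rewrite tailE scaler_sumr.
rewrite pair_bigA /=.
(* A choice for the first slot and a choice for the others amount to one choice function, which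
   reindexes the double sum. *)
pose pack (p : I * {ffun 'I_m -> I}) : {ffun 'I_m.+1 -> I} :=
  [ffun l => if unlift ord0 l is Some l' then p.2 l' else p.1].
pose unpack (h : {ffun 'I_m.+1 -> I}) : I * {ffun 'I_m -> I} :=
  (h ord0, [ffun l => h (lift ord0 l)]).
have packK : cancel pack unpack.
  move=> [i h]; rewrite /unpack /pack ffunE unlift_none /=; congr pair.
  by apply/ffunP => l; rewrite !ffunE liftK.
have unpackK : cancel unpack pack.
  move=> h; apply/ffunP => l; rewrite /unpack /pack ffunE /=.
  by case: unliftP => [j ->|->] //=; rewrite ffunE.
rewrite [RHS](reindex pack); last by exists unpack => p _.
apply: eq_bigr => -[i h] _ /=; rewrite scalerA big_ord_recl /=; congr (_ * _ *: _).
- by rewrite ffunE unlift_none.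
- by apply: eq_bigr => l _; rewrite ffunE liftK.
- rewrite [X in _ = M X]consE; congr (M (ord_cons _ _)).
    by rewrite ffunE unlift_none.
  by apply/funext => l; rewrite ffunE liftK.
Qed.

Lemma multilinear_sum m (M : ('I_m -> V) -> V) (I : finType) (x : 'I_m -> I -> V) :
  multilinear M ->
  M (fun l => \sum_i x l i) = \sum_(h : {ffun 'I_m -> I}) M (fun l => x l (h l)).
Proof.
move=> Ml; have := multilinear_expand (fun _ _ => 1) x Ml.
have -> : (fun l => \sum_i 1 *: x l i) = (fun l => \sum_i x l i).
  by apply/funext => l; apply: eq_bigr => i _; rewrite scale1r.
move=> ->; apply: eq_bigr => h _; rewrite big1 ?scale1r //.
Qed.

(** This reduces rates and class membership of [M w] to those of products of scalar coordinates. *)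
Lemma multilinear_coord m (M : ('I_m -> V) -> V) (w : 'I_m -> V) i : multilinear M ->
  M w i 0 = \sum_(h : {ffun 'I_m -> 'I_n})
    M (fun l => delta_mx (h l) 0) i 0 * \prod_l w l (h l) 0.
Proof.
move=> Ml; have -> : w = (fun l => \sum_j w l j 0 *: delta_mx j 0).
  by apply/funext => l; exact: col_delta_sum.
rewrite (multilinear_expand (fun l j => w l j 0) (fun _ j => delta_mx j 0) Ml).
rewrite summxE; apply: eq_bigr => h _; rewrite mxE mulrC; congr (_ * _).
by apply: eq_bigr => l _; congr (fun_of_matrix _ _ _); exact: col_delta_sum.
Qed.

Lemma expO_prod m (a : 'I_m -> R) (f : 'I_m -> R -> R[i]) :
  (forall l, expO (f l) (a l)) ->
  expO (fun t => \prod_(l < m) f l t) (\sum_(l < m) a l).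
Proof.
elim: m a f => [|m ih] a f fa.
  rewrite big_ord0; exists 0, 1 => t _.
  by rewrite big_ord0 ComplexField.Normc.normc1 oppr0 mul0r expR0 mulr1.
rewrite big_ord_recl.
apply: expO_eq (expOM (fa ord0) (ih _ _ (fun l => fa (lift ord0 l)))) _ => t.
by rewrite big_ord_recl.
Qed.

Lemma multilinear_vexpO m (M : ('I_m -> V) -> V) (a : 'I_m -> R)
    (w : 'I_m -> R -> V) : multilinear M -> (forall l, vexpO (w l) (a l)) ->
  vexpO (fun t => M (fun l => w l t)) (\sum_l a l).
Proof.
move=> Ml wO i.
apply: (@expO_eq _ (fun t => \sum_(h : {ffun 'I_m -> 'I_n})
    M (fun l => delta_mx (h l) 0) i 0 * \prod_l w l t (h l) 0)).
  by apply: expO_sum => h _; apply: expOZ; apply: expO_prod => l; exact: wO.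
by move=> t; rewrite -(multilinear_coord _ i Ml).
Qed.

Lemma multilinear_FE m (M : ('I_m -> V) -> V) (a : 'I_m -> R)
    (w : 'I_m -> R -> V) : multilinear M -> (forall l, FE (a l) (w l)) ->
  FE (\sum_l a l) (fun t => M (fun l => w l t)).
Proof.
move=> Ml wO; apply/FE_qexp => i.
apply: (@qexp_eq _ _ (fun t => \sum_(h : {ffun 'I_m -> 'I_n})
    M (fun l => delta_mx (h l) 0) i 0 * \prod_l w l t (h l) 0)).
  apply: qexp_sum => h _; apply: qexpZ; apply: qexp_prod => l.
  by have /FE_qexp := wO l; exact.
by move=> t; rewrite -(multilinear_coord _ i Ml).
Qed.

(** After expansion every remaining term has at least one factor [u]. One such factor is counted at
    rate [b], the other [m - 1] factors at rate [a], and [b + (m - 1) a >= a + b] as [a >= 0] and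
    [m >= 2]. *)
Lemma multilinear_perturbation m (M : ('I_m -> V) -> V) (s u : R -> V) (a b : R) :
  multilinear M -> (2 <= m)%N -> 0 <= a -> vexpO s a -> vexpO u a -> vexpO u b ->
  vexpO (fun t => M (fun=> s t + u t) - M (fun=> s t)) (a + b).
Proof.
move=> Ml m2 a0 sO uO uO'.
pose x (t : R) (c : bool) := if c then u t else s t.
have E t : M (fun=> s t + u t) - M (fun=> s t) =
    \sum_(h : {ffun 'I_m -> bool} | h != [ffun=> false]) M (fun l => x t (h l)).
  have -> : (fun _ : 'I_m => s t + u t) = (fun=> \sum_c x t c).
    by apply/funext => _; rewrite big_bool addrC.
  rewrite (multilinear_sum (fun _ => x t) Ml) (bigD1 [ffun=> false]) //=.
  have -> : (fun l : 'I_m => x t ([ffun=> false] l)) = (fun=> s t).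
    by apply/funext => l; rewrite ffunE.
  by rewrite addrC addrK.
move=> i; apply: (@expO_eq _ (fun t =>
    \sum_(h : {ffun 'I_m -> bool} | h != [ffun=> false])
      M (fun l => x t (h l)) i 0)); last first.
  by move=> t; rewrite E summxE.
apply: expO_sum => h hneq.
have [l0 hl0] : exists l0, h l0.
  apply/existsP; apply: contra_neqT hneq => /existsPn h0.
  by apply/ffunP => l; rewrite ffunE; apply/negbTE/h0.
have hO l : vexpO (fun t => x t (h l)) (if l == l0 then b else a).
  by case: eqP => [->|_]; rewrite /x ?hl0 //; case: (h l).
apply: expO_le (multilinear_vexpO Ml hO i).
rewrite (bigD1 l0) //= eqxx [a + b]addrC lerD2l.
rewrite (eq_bigr (fun=> a)); last by move=> l /negbTE ->.
rewrite sumr_const -mulr_natl ler_peMl // ler1n.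
by rewrite cardC1 card_ord -subn1 subn_gt0.
Qed.

End Multilinear.

(** * Expansion of the nonlinearity into resonant sums *)

Section Nonlinearity.
Variables (R : realType) (n : nat).
Local Notation V := 'cV[R[i]]_n.

Lemma enorm_ge0 (x : V) : 0 <= enorm x.
Proof. exact: sqrtr_ge0. Qed.

Lemma enorm_sqr (x : V) : enorm x ^+ 2 = sqnorm x.
Proof.
rewrite /enorm sqr_sqrtr; last by apply: sumr_ge0 => i _; rewrite addr_ge0 ?sqr_ge0.
by apply: eq_bigr => i _; rewrite normc_sqr.
Qed.

Lemma normc_le_enorm (x : V) i : normc (x i 0) <= enorm x.
Proof.
rewrite -ler_sqr ?nnegrE ?normc_ge0 ?enorm_ge0 // enorm_sqr /sqnorm (bigD1 i) //=.
by rewrite lerDl sumr_ge0 // => j _; exact: sqr_ge0.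
Qed.

Lemma vexpO_bigO (u : R -> V) (a : R) :
  vexpO u a <-> bigO_infty u (fun t => expR (- a * t)).
Proof.
split=> [/vexpO_sqnorm[T [C h]]|[T [C [_ _ h]]] i]; last first.
  by exists T, C => t Tt; apply: le_trans (normc_le_enorm _ _) (h t Tt).
exists (`|T| + 1), (`|C| + 1); split; rewrite ?ltr_wpDl // => t Tt.
rewrite -ler_sqr ?nnegrE ?enorm_ge0 ?mulr_ge0 ?expR_ge0 ?addr_ge0 // enorm_sqr.
have /h/le_trans : T <= t by have := ler_norm T; lra.
apply; have -> : - (2 * a) * t = - a * t + - a * t by ring.
rewrite expRD exprMn [expR _ ^+ 2]expr2 ler_wpM2r ?mulr_ge0 ?expR_ge0 //.
have := ler_norm C; have := normr_ge0 C; have := sqr_ge0 `|C|; lra.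
Qed.

Variable mu : nat -> R.
Hypothesis mu_gt0 : forall k, 0 < mu k.
Hypothesis mu_incr : {homo mu : i j / (i < j)%N >-> i < j}.
Hypothesis mu_add : forall x y, range mu x -> range mu y -> range mu (x + y).

Lemma mu_le i j : (i <= j)%N -> mu i <= mu j.
Proof. by rewrite leq_eqVlt => /predU1P[->//|/mu_incr/ltW]. Qed.

Lemma mu_lt_lt i j : mu i < mu j -> (i < j)%N.
Proof. by move=> h; rewrite ltnNge; apply/negP => /mu_le; rewrite leNgt h. Qed.

Lemma mu_inj : injective mu.
Proof.
by move=> i j E; have [/mu_incr|/mu_incr|//] := ltngtP i j; rewrite E ltxx.
Qed.

Lemma mu_sum_range m (j : 'I_m.+1 -> nat) : range mu (\sum_l mu (j l)).
Proof.
elim: m j => [|m ih] j; first by rewrite big_ord1; exists (j ord0).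
by rewrite big_ord_recl; apply: mu_add; [exists (j ord0) | exact: ih].
Qed.

Variable GG : forall m, ('I_m -> V) -> V.

(** A sum of [m] exponents is at least [m * mu 0], which excludes [m > M], and resonant indices are
    below [k <= N]. The same finite ranges serve all [k <= N], so sums over [k] can be exchanged
    with them. *)
Lemma resonant_sumE (y : nat -> R -> V) (N M k : nat) t :
  (k <= N)%N -> mu N < M.+1%:R * mu 0%N ->
  resonant_sum mu GG y k t = \sum_(2 <= m < M.+1)
    \sum_(g : {ffun 'I_m -> 'I_N} | \sum_l mu (g l) == mu k) GG (fun l => y (g l) t).
Proof.
move=> kN MN; rewrite /resonant_sum (fsbigE (index_iota 2 M.+1)) ?iota_uniq //; first last.
- move=> m /= m2; rewrite mem_index_iota m2 /= -leqNgt => Mm.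
  have -> : @resonances R mu k m = set0.
    rewrite -subset0 => j /= jk.
    have : m%:R * mu 0%N <= mu k.
      rewrite -jk mulr_natl -[X in _ *+ X](card_ord m) -sumr_const.
      by apply: ler_sum => l _; exact: mu_le.
    apply/negP; rewrite -ltNge; apply: le_lt_trans (mu_le kN) _.
    by apply: lt_le_trans MN _; rewrite ler_pM2r // ler_nat.
  exact: fsbig_set0.
- by move=> m /=; rewrite mem_index_iota => /andP[].
rewrite big_seq_cond [RHS]big_seq; apply: eq_big => m.
  rewrite mem_index_iota; case: ltnP => //= m2.
  by rewrite andb_idr // => _; rewrite inE.
move=> /andP[]; rewrite mem_index_iota => /andP[m2 _] _.
pose emb (g : {ffun 'I_m -> 'I_N}) : {ffun 'I_m -> nat} := [ffun l => val (g l)].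
have emb_inj : injective emb.
  by move=> g h /ffunP E; apply/ffunP => l; apply: val_inj; have := E l; rewrite !ffunE.
pose r := map emb [seq g <- index_enum {ffun 'I_m -> 'I_N} |
  \sum_l mu ((g : {ffun 'I_m -> 'I_N}) l) == mu k].
have r_uniq : uniq r by rewrite map_inj_uniq // filter_uniq // index_enum_uniq.
have -> : @resonances R mu k m = [set` r].
  apply/seteqP; split => [j jk|j] /=.
    pose g : {ffun 'I_m -> 'I_N} := [ffun l =>
      Ordinal (leq_trans (resonances_lt mu_gt0 mu_incr m2 jk l) kN)].
    apply/mapP; exists g; last by apply/ffunP => l; rewrite !ffunE.
    rewrite mem_filter mem_index_enum andbT; apply/eqP; rewrite -jk.
    by apply: eq_bigr => l _; rewrite ffunE.
  move=> /mapP[g]; rewrite mem_filter => /andP[/eqP gk _] ->.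
  by rewrite /resonances /= -gk; apply: eq_bigr => l _; rewrite ffunE.
rewrite -fsbig_seq // big_map big_filter; apply: eq_bigr => g _; congr GG.
by apply/funext => l; rewrite ffunE.
Qed.

(** By the semigroup property each total exponent is some [mu k], with [k] unique since [mu] is
    injective; summing over [k <= N] thus collects each combination of total at most [mu N] exactly
    once. *)
Lemma sum_resonant_sum (y : nat -> R -> V) (N M : nat) t : mu N < M.+1%:R * mu 0%N ->
  \sum_(k < N.+1) resonant_sum mu GG y k t = \sum_(2 <= m < M.+1)
    \sum_(g : {ffun 'I_m -> 'I_N} | \sum_l mu (g l) <= mu N) GG (fun l => y (g l) t).
Proof.
move=> MN.
under eq_bigr => k _ do rewrite (resonant_sumE y t (leq_ord k) MN).
rewrite exchange_big /=; apply: eq_big_nat => -[//|m] /andP[m2 _].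
under eq_bigr => k _ do rewrite big_mkcond.
rewrite exchange_big /= [RHS]big_mkcond; apply: eq_bigr => g _.
have [k0 _ k0E] := mu_sum_range (fun l => g l).
rewrite -k0E; have [k0N|Nk0] := leP (mu k0) (mu N).
  have k0N' : (k0 < N.+1)%N by rewrite ltnNge; apply/negP => /mu_incr; rewrite ltNge k0N.
  rewrite (bigD1 (Ordinal k0N')) //= eqxx big1 ?addr0 // => k kk0.
  by rewrite ifF //; apply/eqP => /mu_inj E; move/eqP: kk0; apply; exact: val_inj.
rewrite big1 // => k _; rewrite ifF //; apply/eqP => E.
by move: Nk0; rewrite E ltNge mu_le // -ltnS.
Qed.

Hypothesis GG_lin : forall m, (2 <= m)%N -> multilinear (@GG m).

Lemma FE_resonant_sum (y : nat -> R -> V) k :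
  (forall j, (j < k)%N -> FE (- mu j) (y j)) -> FE (- mu k) (resonant_sum mu GG y k).
Proof.
move=> yFE.
pose M := Num.truncn (mu k / mu 0%N).
have MN : mu k < M.+1%:R * mu 0%N by rewrite -ltr_pdivrMr //; exact: truncnS_gt.
apply/FE_qexp => i.
apply: (@qexp_eq _ _ (fun t => \sum_(m <- index_iota 2 M.+1 | m \in index_iota 2 M.+1)
    \sum_(g : {ffun 'I_m -> 'I_k} | \sum_l mu (g l) == mu k)
      GG (fun l => y (g l) t) i 0)); last first.
  move=> t; rewrite (resonant_sumE y t (leqnn k) MN) summxE -big_seq.
  by apply: eq_bigr => m _; rewrite summxE.
apply: qexp_sum => m; rewrite mem_index_iota => /andP[m2 _].
apply: qexp_sum => g /eqP gk.
have /(multilinear_FE (GG_lin m2)) : forall l, FE (- mu (g l)) (y (g l)).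
  by move=> l; exact: yFE.
by rewrite sumrN gk => /FE_qexp; exact.
Qed.

Variables (G : V -> V) (Gm : nat -> V -> V).
Hypothesis G_exp : power_expansion G Gm.
Hypothesis GG_diag : forall m, (2 <= m)%N -> forall x, Gm m x = GG (fun _ : 'I_m => x).

(** Along [y = O(exp (- a t))] a remainder of order [M + delta] has rate at least [M * a], and the
    order is arbitrary. The demand [M0 <= M] lets the caller include every degree that can
    resonate. *)
Lemma power_expansion_remainder (y : R -> V) (a b : R) (M0 : nat) :
  0 < a -> vexpO y a -> exists2 M : nat, (M0 <= M)%N &
  vexpO (fun t => G (y t) - \sum_(2 <= m < M.+1) Gm m (y t)) b.
Proof.
move=> a0 /vexpO_bigO[T [C [T0 C0 yC]]].
pose M := maxn 2 (maxn M0 (Num.truncn (b / a)).+1).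
have M2 : (2 <= M)%N by rewrite leq_maxl.
have Mb : b <= M%:R * a.
  rewrite -ler_pdivrMr //; apply: le_trans (ltW (truncnS_gt _)) _.
  by rewrite ler_nat !leq_max leqnn !orbT.
have [del del0 [r [K [r0 K0 GK]]]] := G_exp M2.
exists M; first by rewrite !leq_max leqnn !orbT.
have pw0 : 0 <= M%:R + del by rewrite addr_ge0 // ltW.
(* Beyond [C / (r * a)] the solution is inside the ball where the expansion holds, since
   [C <= r * (a * t) < r * expR (a * t)]. *)
move=> i; exists (Num.max T (C / (r * a))), (K * C `^ (M%:R + del)) => t.
rewrite ge_max => /andP[Tt Ct]; have t0 : 0 < t by rewrite (lt_le_trans T0).
have yr : enorm (y t) < r.
  apply: le_lt_trans (yC t Tt) _; rewrite mulNr expRN ltr_pdivrMr ?expR_gt0 //.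
  move: Ct; rewrite ler_pdivrMr ?mulr_gt0 // => Ct.
  have := expR_ge1Dx (a * t); rewrite -(ler_pM2l r0) mulrDr mulr1; lra.
apply: le_trans (normc_le_enorm _ _) _; apply: le_trans (GK _ yr) _.
rewrite -mulrA ler_pM2l //.
apply: (@le_trans _ _ ((C * expR (- a * t)) `^ (M%:R + del))).
  by apply: ge0_ler_powR; rewrite ?nnegrE ?enorm_ge0 ?mulr_ge0 ?expR_ge0 ?(ltW C0) // yC.
rewrite powRM ?expR_ge0 ?(ltW C0) // -expRM ler_wpM2l ?powR_ge0 // ler_expR.
rewrite [- b * t]mulNr -mulrA mulNr lerN2 mulrA mulrAC ler_pM2r //.
have := mulr_ge0 (ltW a0) (ltW del0); lra.
Qed.

(** The difference splits into the remainder of [G] at high order, the effect [D1] of replacing [y]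
    by the partial sum [s], of rate [a + nu], and the combinations [D2] of total exponent above
    [mu N], which the semigroup property pushes up to [mu N.+1] or more. *)
Lemma nonlinear_remainder (y : R -> V) (yk : nat -> R -> V) (N : nat) (a nu : R) :
  (forall j, (j < N)%N -> FE (- mu j) (yk j)) ->
  0 < a -> a < mu 0%N -> a <= nu -> mu N < a + nu -> vexpO y a ->
  vexpO (fun t => y t - \sum_(k < N) yk k t) nu ->
  exists2 e, 0 < e & vexpO (fun t =>
    G (y t) - \sum_(k < N.+1) resonant_sum mu GG yk k t) (mu N + e).
Proof.
move=> ykFE a0 amu anu Nanu yO uO.
pose s t := \sum_(k < N) yk k t; pose u t := y t - s t.
have sO : vexpO s a.
  move=> i; apply: (@expO_eq _ (fun t => \sum_(k < N) yk k t i 0)); last first.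
    by move=> t; rewrite summxE.
  apply: expO_sum => k _; apply: (@qexp_expO _ (mu k)).
    exact: lt_le_trans amu (mu_le (leq0n _)).
  by have /FE_qexp := ykFE k (ltn_ord k); exact.
have muN1 : mu N < mu N.+1 by exact: mu_incr.
(* Half the gap is given up because [D2] carries powers of [t]; the other bound comes from [D1]. *)
pose e := Num.min ((mu N.+1 - mu N) / 2) (a + nu - mu N).
have e0 : 0 < e by rewrite lt_min divr_gt0 ?subr_gt0.
have [e1 e2] : e <= (mu N.+1 - mu N) / 2 /\ e <= a + nu - mu N.
  by rewrite !ge_min !lexx orbT.
have [M M0M GO] := power_expansion_remainder (mu N + e) (Num.truncn (mu N / mu 0%N)) a0 yO.
have MN : mu N < M.+1%:R * mu 0%N.
  rewrite -ltr_pdivrMr //; apply: lt_le_trans (truncnS_gt _) _.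
  by rewrite ler_nat ltnS.
exists e => //.
pose D1 t := \sum_(2 <= m < M.+1)
  (GG (fun _ : 'I_m => s t + u t) - GG (fun _ : 'I_m => s t)).
pose D2 t := \sum_(2 <= m < M.+1) \sum_(g : {ffun 'I_m -> 'I_N} |
  ~~ (\sum_l mu (g l) <= mu N)) GG (fun l => yk (g l) t).
have E t : G (y t) - \sum_(k < N.+1) resonant_sum mu GG yk k t =
    (G (y t) - \sum_(2 <= m < M.+1) Gm m (y t)) + D1 t + D2 t.
  rewrite (sum_resonant_sum yk t MN) /D1 sumrB.
  have -> : \sum_(2 <= m < M.+1) GG (fun _ : 'I_m => s t + u t) =
      \sum_(2 <= m < M.+1) Gm m (y t).
    by apply: eq_big_nat => m /andP[m2 _]; rewrite GG_diag // /u subrKC.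
  have -> : \sum_(2 <= m < M.+1) GG (fun _ : 'I_m => s t) =
      \sum_(2 <= m < M.+1) \sum_(g : {ffun 'I_m -> 'I_N} | \sum_l mu (g l) <= mu N)
        GG (fun l => yk (g l) t) + D2 t.
    rewrite /D2 -big_split /=; apply: eq_big_nat => m /andP[m2 _].
    by rewrite (multilinear_sum (fun _ (k : 'I_N) => yk k t) (GG_lin m2))
      (bigID (fun g : {ffun 'I_m -> 'I_N} => \sum_l mu (g l) <= mu N)).
  by rewrite addrA subrK opprD addrA subrK.
have D1O : vexpO D1 (mu N + e).
  move=> i; apply: (@expO_eq _ (fun t =>
      \sum_(m <- index_iota 2 M.+1 | m \in index_iota 2 M.+1)
      (GG (fun _ : 'I_m => s t + u t) - GG (fun _ : 'I_m => s t)) i 0)); last first.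
    by move=> t; rewrite /D1 summxE -big_seq.
  apply: expO_sum => m; rewrite mem_index_iota => /andP[m2 _].
  have uOa : vexpO u a by move=> j; exact: expO_le anu (uO j).
  apply: expO_le (multilinear_perturbation (GG_lin m2) m2 (ltW a0) sO uOa uO i).
  by lra.
have D2O : vexpO D2 (mu N + e).
  move=> i; apply: (@expO_eq _ (fun t =>
      \sum_(m <- index_iota 2 M.+1 | m \in index_iota 2 M.+1)
      \sum_(g : {ffun 'I_m -> 'I_N} | ~~ (\sum_l mu (g l) <= mu N))
        GG (fun l => yk (g l) t) i 0)); last first.
    by move=> t; rewrite /D2 summxE -big_seq; apply: eq_bigr => m _; rewrite summxE.
  apply: expO_sum => m; rewrite mem_index_iota => /andP[m2 _].
  apply: expO_sum => g; rewrite -ltNge => gN.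
  have gN1 : mu N.+1 <= \sum_l mu (g l).
    case: m m2 g gN => // m m2 g; have [k _ <-] := mu_sum_range (fun l => g l).
    by move=> /mu_lt_lt; exact: mu_le.
  have /(multilinear_FE (GG_lin m2)) : forall l, FE (- mu (g l)) (yk (g l)).
    by move=> l; exact: ykFE.
  rewrite sumrN => /FE_qexp /(_ i); apply: qexp_expO; lra.
by move=> i; apply: expO_eq (expOD (expOD (GO i) (D1O i)) (D2O i)) _ => t; rewrite E !mxE.
Qed.

End Nonlinearity.

(** * Quadratic smallness of [G] near the origin *)

Section SmallSolutions.
Variables (R : realType) (n : nat).
Local Notation V := 'cV[R[i]]_n.

Lemma multilinear_diag_bound m (M : ('I_m -> V) -> V) : multilinear M ->
  exists2 K : R, 0 <= K & forall x i, normc (M (fun=> x) i 0) <= K * enorm x ^+ m.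
Proof.
move=> Ml.
pose c i := \sum_(h : {ffun 'I_m -> 'I_n}) normc (M (fun l => delta_mx (h l) 0) i 0).
have c0 i : 0 <= c i by apply: sumr_ge0 => h _; exact: normc_ge0.
exists (\sum_i c i); first exact: sumr_ge0.
move=> x i; apply: (@le_trans _ _ (c i * enorm x ^+ m)).
  rewrite (multilinear_coord _ i Ml); apply: le_trans (normc_sum _ _ _) _.
  rewrite mulr_suml; apply: ler_sum => h _.
  rewrite ComplexField.Normc.normcM ler_wpM2l ?normc_ge0 // normc_prod.
  rewrite -[X in _ ^+ X](card_ord m) -prodr_const; apply: ler_prod => l _.
  by rewrite normc_ge0 normc_le_enorm.
rewrite ler_wpM2r ?exprn_ge0 ?enorm_ge0 // (bigD1 i) //= lerDl.
by apply: sumr_ge0.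
Qed.

(** Order two of the expansion is enough: with radius at most 1, the error [|x| ^ (2 + delta)] is
    dominated by [|x| ^ 2], like the quadratic term itself. *)
Lemma power_expansion_quadratic (G : V -> V) (Gm : nat -> V -> V)
    (M : ('I_2 -> V) -> V) : power_expansion G Gm -> multilinear M ->
  (forall x, Gm 2 x = M (fun=> x)) ->
  exists r K : R, [/\ 0 < r, 0 <= K & forall x, enorm x < r ->
    sqnorm (G x) <= K * sqnorm x ^+ 2].
Proof.
move=> G_exp Ml Gm2.
have [del del0 [r [C [r0 C0 GC]]]] := G_exp 2 isT.
have [K K0 MK] := multilinear_diag_bound Ml.
exists (Num.min r 1), (n%:R * (C + K) ^+ 2); split.
- by rewrite lt_min r0 ltr01.
- by rewrite mulr_ge0 // sqr_ge0.
move=> x; rewrite lt_min => /andP[xr x1]; have x0 := enorm_ge0 x.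
have pw : enorm x `^ (2%:R + del) <= enorm x ^+ 2.
  have [->|xn0] := eqVneq (enorm x) 0.
    by rewrite expr0n /= powR0 // gt_eqF // ltr_wpDl.
  rewrite -powR_mulrn //; apply: ger_powR; last by rewrite lerDl ltW.
  by rewrite lt_def xn0 x0 ltW.
have Gi i : normc (G x i 0) <= (C + K) * enorm x ^+ 2.
  have -> : G x i 0 = (G x - Gm 2 x) i 0 + Gm 2 x i 0 by rewrite !mxE subrK.
  apply: le_trans (le_normcD _ _) _; rewrite mulrDl; apply: lerD.
    apply: le_trans (normc_le_enorm _ _) _.
    have := GC x xr; rewrite big_nat1 => /le_trans; apply.
    by rewrite ler_pM2l.
  by rewrite Gm2.
apply: (@le_trans _ _ (\sum_(i < n) ((C + K) * enorm x ^+ 2) ^+ 2)).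
  apply: ler_sum => i _; rewrite ler_sqr ?nnegrE ?normc_ge0 //.
  exact: le_trans (normc_ge0 _) (Gi i).
by rewrite sumr_const card_ord -[_ *+ n]mulr_natl -enorm_sqr exprMn mulrA.
Qed.

Lemma vanishing_eventually_small (y : R -> V) (rho : R) : 0 < rho ->
  enorm (y t) @[t --> +oo] --> 0 -> exists T, forall t, T <= t -> enorm (y t) < rho.
Proof.
move=> rho0 /cvgr0_norm_lt /(_ _ rho0) [T [_ h]].
exists (T + 1) => t Tt; have := h t; rewrite /= ger0_norm ?enorm_ge0 //; apply.
by apply: lt_le_trans Tt; rewrite ltrDl.
Qed.

End SmallSolutions.

(** * Induction on the number of terms of the expansion *)

Section Expansion.
Variables (R : realType) (n : nat).
Local Notation V := 'cV[R[i]]_n.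
Hypothesis n_gt0 : (0 < n)%N.
Variables (A : 'M[R[i]]_n) (G : V -> V) (Gm : nat -> V -> V).
Variable GG : forall m : nat, ('I_m -> V) -> V.
Hypothesis G_exp : power_expansion G Gm.
Hypothesis GG_lin : forall m, (2 <= m)%N -> multilinear (@GG m).
Hypothesis GG_diag : forall m, (2 <= m)%N -> forall x, Gm m x = GG (fun _ : 'I_m => x).
Variable mu : nat -> R.
Hypothesis mu_gt0 : forall k, 0 < mu k.
Hypothesis mu_incr : {homo mu : i j / (i < j)%N >-> i < j}.
Hypothesis mu_add : forall x y, range mu x -> range mu y -> range mu (x + y).
Hypothesis mu_spec : forall L : R[i], eigenvalue A L -> range mu (Re L).
Variables (f : R -> V) (fk : nat -> R -> V).
Hypothesis fk_FE : forall k, FE (- mu k) (fk k).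
Hypothesis f_exp : exp_expansion mu f fk.
Variables (T0 : R) (y : R -> V).
Hypothesis y_sol : forall t, T0 < t -> is_vderive y t (- (A *m y t) + G (y t) + f t).
Hypothesis y_cvg0 : enorm (y t) @[t --> +oo] --> 0.

Lemma forcing_vexpO a : a < mu 0 -> vexpO f a.
Proof.
move=> am i; have [nu nu0 /vexpO_bigO fO] := f_exp 0.
have f0 : expO (fun t => fk 0 t i 0) a.
  by apply: (qexp_expO am); have /FE_qexp := fk_FE 0; exact.
have fO' : expO (fun t => (f t - \sum_(k < 1) fk k t) i 0) a.
  by apply: expO_le (fO i); rewrite ltW // (lt_trans am).
by apply: expO_eq (expOD fO' f0) _ => t; rewrite big_ord1 !mxE subrK.
Qed.

Lemma solution_vexpO a : a < mu 0 -> vexpO y a.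
Proof.
apply: (exponential_decay n_gt0 _ y_sol _ forcing_vexpO).
  by move=> L /mu_spec[k _ <-]; exact: mu_le.
move=> eta eta0.
have [r [K [r0 K0 GK]]] := power_expansion_quadratic G_exp (GG_lin (leqnn 2))
  (GG_diag (leqnn 2)).
have K10 : 0 < K + 1 by rewrite ltr_wpDl.
(* Inside this radius [K * sqnorm y <= eta], so the quadratic bound on [G] becomes the linear
   smallness that the Lyapunov argument requires. *)
pose rho := Num.min r (Num.sqrt (eta / (K + 1))).
have rho0 : 0 < rho by rewrite lt_min r0 sqrtr_gt0 divr_gt0.
have [T yT] := vanishing_eventually_small rho0 y_cvg0.
exists T => t /yT; rewrite lt_min => /andP[yr yeta].
apply: le_trans (GK _ yr) _; rewrite expr2 mulrA ler_wpM2r ?sqnorm_ge0 //.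
have : sqnorm (y t) <= eta / (K + 1).
  rewrite -enorm_sqr -[X in _ <= X]sqr_sqrtr; last by rewrite divr_ge0 // ltW.
  by rewrite ler_sqr ?nnegrE ?enorm_ge0 ?sqrtr_ge0 // ltW.
rewrite ler_pdivlMr // => h.
have := sqnorm_ge0 (y t); lra.
Qed.

(** Resonant indices are below [k]; this is why appending a term to the sequence preserves the
    equations already obtained. *)
Lemma resonant_sum_ext (z z' : nat -> R -> V) k t :
  (forall j, (j < k)%N -> z j = z' j) ->
  resonant_sum mu GG z k t = resonant_sum mu GG z' k t.
Proof.
move=> zz'; apply: eq_fsbigr => m; rewrite inE /= => m2.
apply: eq_fsbigr => j; rewrite inE => jk; congr GG.
by apply/funext => l; rewrite zz' // (resonances_lt mu_gt0 mu_incr m2 jk).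
Qed.

(* No real part of an eigenvalue lies in [nu, mu N), and a product with one factor of
   rate [nu] and another of rate close to [Num.min (mu 0) nu] decays faster than
   [exp (- mu N t)]. *)
Definition partial_expansion (N : nat) (yk : nat -> R -> V) : Prop :=
  (forall k, (k < N)%N -> FE (- mu k) (yk k) /\ forall t,
     is_vderive (yk k) t (- (A *m yk k t) + (resonant_sum mu GG yk k t + fk k t))) /\
  exists nu, [/\ nu < mu N, mu N < nu + mu 0, mu N < nu + nu,
    forall k, (k < N)%N -> mu k < nu & vexpO (fun t => y t - \sum_(k < N) yk k t) nu].

Lemma partial_expansion_ext N (z z' : nat -> R -> V) :
  (forall j, (j < N)%N -> z j = z' j) -> partial_expansion N z -> partial_expansion N z'.
Proof.
move=> zz' [zP [nu [nu1 nu2 nu3 nu4 zO]]]; split.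
  move=> k kN; have [zFE dz] := zP k kN; rewrite -zz' //; split => // t.
  rewrite -(@resonant_sum_ext z z') // => j jk; apply: zz'; exact: ltn_trans kN.
exists nu; split => //.
have -> : (fun t => y t - \sum_(k < N) z' k t) = (fun t => y t - \sum_(k < N) z k t).
  by apply/funext => t; congr (_ - _); apply: eq_bigr => k _; rewrite zz'.
by [].
Qed.

Lemma partial_expansion0 yk : partial_expansion 0 yk.
Proof.
(* Any fraction strictly between 1/2 and 1 would do: the rate must be below [mu 0] and its double
   above. *)
split => //; have mu0 := mu_gt0 0; exists (3 / 4 * mu 0); split => //; try lra.
have -> : (fun t => y t - \sum_(k < 0) yk k t) = y.
  by apply/funext => t; rewrite big_ord0 subr0.
by apply: solution_vexpO; lra.
Qed.

Lemma partial_expansionS N yk : partial_expansion N yk ->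
  exists z, partial_expansion N.+1 (fun k => if k == N then z else yk k).
Proof.
move=> [ykP [nu [nu1 nu2 nu3 nu4 uO]]].
pose u t := y t - \sum_(k < N) yk k t.
(* [a] is the midpoint of [mu N - nu] and [b]: above the first, so that [mu N < a + nu], and below
   both [mu 0] and [nu]. The conditions [mu N < nu + mu 0] and [mu N < nu + nu] make room for it. *)
pose b := Num.min (mu 0) nu; pose a := (mu N - nu + b) / 2.
have [b1 b2] : b <= mu 0 /\ b <= nu by rewrite /b !ge_min !lexx orbT.
have bN : mu N - nu < b by rewrite /b lt_min; apply/andP; split; lra.
have [a0 ab] : 0 < a /\ a < b by rewrite /a; split; lra.
have am : a < mu 0 by lra.
have anu : a <= nu by lra.
have Nanu : mu N < a + nu by rewrite /a; lra.
have ykFE k : (k < N)%N -> FE (- mu k) (yk k) by move=> /ykP[].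
have [eG eG0 GO] := nonlinear_remainder mu_gt0 mu_incr mu_add GG_lin G_exp GG_diag
  ykFE a0 am anu Nanu (solution_vexpO am) uO.
have [nuf nuf0 /vexpO_bigO fO] := f_exp N.
pose e := Num.min eG (nuf - mu N).
have e0 : 0 < e by rewrite lt_min eG0 subr_gt0.
have [e1 e2] : e <= eG /\ e <= nuf - mu N by rewrite /e !ge_min !lexx orbT.
pose h t := resonant_sum mu GG yk N t + fk N t.
pose r t := (G (y t) - \sum_(k < N.+1) resonant_sum mu GG yk k t) +
            (f t - \sum_(k < N.+1) fk k t).
have hFE : FE (- mu N) h.
  by apply: FED => //; exact: (FE_resonant_sum mu_gt0 mu_incr GG_lin ykFE).
have rO : vexpO r (mu N + e).
  move=> i; apply: expO_eq (expOD (expO_le _ (GO i)) (expO_le _ (fO i))) _.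
  - by rewrite lerD2l.
  - by lra.
  - by move=> t; rewrite /r [RHS]mxE.
have du t : T0 < t -> is_vderive u t (- (A *m u t) + h t + r t).
  move=> Tt.
  have : is_vderive u t ((- (A *m y t) + G (y t) + f t) - \sum_(k < N)
      (- (A *m yk k t) + (resonant_sum mu GG yk k t + fk k t))).
    move=> i.
    have : cderive (fun s => y s i 0 - \sum_(k < N) yk k s i 0) t
        ((- (A *m y t) + G (y t) + f t) i 0 - \sum_(k < N)
         (- (A *m yk k t) + (resonant_sum mu GG yk k t + fk k t)) i 0).
      apply: cderiveB; first exact: y_sol.
      by apply: cderive_sum => k; have [_ dk] := ykP k (ltn_ord k); exact: dk.
    have -> : (fun s => y s i 0 - \sum_(k < N) yk k s i 0) = (fun s => u s i 0).
      by apply/funext => s; rewrite /u !mxE summxE.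
    rewrite -summxE; set v := - _ + _ + _; set w := \sum_(k < N) _.
    by rewrite (_ : v i 0 - w i 0 = (v - w) i 0) // [RHS]mxE [X in _ = _ + X]mxE.
  congr is_vderive.
  (* The equations of the [yk k] with [k < N] cancel the resonant sums and forcings of index below
     [N]; those of index [N] form [h], and the rest is [r]. *)
  rewrite big_split /= big_split /= /u /h /r !big_ord_recr /= mulmxBr mulmx_sumr sumrN.
  set a1 := A *m y t; set a2 := \sum_(k < N) _; set a3 := \sum_(k < N) _.
  set a4 := \sum_(k < N) _; set a5 := resonant_sum _ _ _ N t.
  by apply/colP => i; rewrite !mxE; ring.
have AP L : eigenvalue A L -> Re L < nu \/ mu N <= Re L.
  move=> /mu_spec[k _ <-]; have [kN|Nk] := ltnP k N; first by left; exact: nu4.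
  by right; exact: mu_le.
have [z [e' [e'0 zFE dz zO]]] := linear_asymptotics n_gt0 du hFE e0 rO nu1 uO AP.
exists z; set yk' := fun k => _.
have ykE k : (k < N)%N -> yk k = yk' k by rewrite /yk' => kN; rewrite ltn_eqF.
have ykN : yk' N = z by rewrite /yk' eqxx.
split.
  move=> k; rewrite ltnS leq_eqVlt => /predU1P[->|kN].
    rewrite ykN; split => // t; rewrite -(@resonant_sum_ext yk yk') //.
  have [FEk dk] := ykP k kN; rewrite -ykE //; split => // t.
  rewrite -(@resonant_sum_ext yk yk') // => j jk; apply: ykE; exact: ltn_trans kN.
have muS : mu N < mu N.+1 by exact: mu_incr.
(* By the semigroup property consecutive exponents differ by at most [mu 0]. Hence any rate above
   [mu N] meets both sum conditions of the invariant at [N.+1], the second because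
   [mu 0 <= mu N]. *)
have muS0 : mu N.+1 <= mu N + mu 0.
  have [k _ kE] : range mu (mu N + mu 0) by apply: mu_add; [exists N | exists 0%N].
  by rewrite -kE; apply: mu_le => //; apply: (mu_lt_lt mu_incr); rewrite kE ltrDl.
pose e'' := Num.min e' ((mu N.+1 - mu N) / 2).
have e''0 : 0 < e'' by rewrite lt_min e'0 divr_gt0 // subr_gt0.
have [e3 e4] : e'' <= e' /\ e'' <= (mu N.+1 - mu N) / 2.
  by rewrite /e'' !ge_min !lexx orbT.
have mu0N : mu 0 <= mu N by exact: mu_le.
exists (mu N + e''); split; try lra.
  by move=> k; rewrite ltnS => /(mu_le mu_incr) /le_lt_trans; apply; rewrite ltrDl.
move=> i; apply: (@expO_eq _ (fun t => (u t - z t) i 0)).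
  by apply: expO_le (zO i); rewrite lerD2l.
move=> t; rewrite big_ord_recr /= ykN /u opprD addrA; congr (fun_of_matrix (_ - _ - _) _ _).
by apply: eq_bigr => k _; rewrite ykE.
Qed.

Lemma full_expansion : exists yk, forall N, partial_expansion N yk.
Proof.
(* [choice] needs a statement for all pairs, so an arbitrary value is supplied when [p] is not a
   partial expansion. *)
have step (p : nat * (nat -> R -> V)) : exists z, partial_expansion p.1 p.2 ->
    partial_expansion p.1.+1 (fun k => if k == p.1 then z else p.2 k).
  have [/partial_expansionS[z zP]|nP] := pselect (partial_expansion p.1 p.2).
    by exists z.
  by exists (fun=> 0).
have [F FP] := choice step.
(* [Y N.+1] alters only index [N] of [Y N], so entry [k] is final from stage [k.+1] on and the
   diagonal agrees with every stage on its indices. *)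
pose Y := fix Y N : nat -> R -> V :=
  if N is N'.+1 then (fun k => if k == N' then F (N', Y N') else Y N' k)
  else (fun _ _ => 0).
have YP N : partial_expansion N (Y N).
  elim: N => [|N ih]; first exact: partial_expansion0.
  exact: (FP (N, Y N) ih).
have YE N k : (k < N)%N -> Y N k = Y k.+1 k.
  elim: N => // N ih; rewrite ltnS leq_eqVlt => /predU1P[->//|kN].
  by rewrite -ih //= ltn_eqF.
exists (fun k => Y k.+1 k) => N.
by apply: partial_expansion_ext (YP N) => k; exact: YE.
Qed.

End Expansion.

Theorem theorem7p7 (R : realType) (n : nat) (n_gt0 : (0 < n)%N)
    (A : 'M[R[i]]_n)
    (A_spec : forall L : R[i], eigenvalue A L -> 0 < complex.Re L)
    (G : 'cV[R[i]]_n -> 'cV[R[i]]_n)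
    (Gm : nat -> 'cV[R[i]]_n -> 'cV[R[i]]_n)
    (GG : forall m : nat, ('I_m -> 'cV[R[i]]_n) -> 'cV[R[i]]_n)
    (G_lip : locally_lipschitz G)
    (Gm_hom : forall m, (2 <= m)%N -> homogeneous_polynomial m (Gm m))
    (G_exp : power_expansion G Gm)
    (GG_lin : forall m, (2 <= m)%N -> multilinear (GG m))
    (GG_diag : forall m, (2 <= m)%N -> forall x, Gm m x = GG m (fun=> x))
    (f : R -> 'cV[R[i]]_n) (Tf : R) (Tf_ge0 : 0 <= Tf)
    (f_cont : vcontinuous [set t | 0 < t /\ Tf <= t] f)
    (mu : nat -> R)
    (mu_gt0 : forall k, 0 < mu k)
    (mu_incr : {homo mu : i j / (i < j)%N >-> i < j})
    (mu_div : mu @ \oo --> +oo)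
    (mu_add : forall x y, range mu x -> range mu y -> range mu (x + y))
    (mu_spec : forall L : R[i], eigenvalue A L -> range mu (complex.Re L))
    (fk : nat -> R -> 'cV[R[i]]_n)
    (fk_FE : forall k, FE (- mu k) (fk k))
    (f_exp : exp_expansion mu f fk)
    (T0 : R) (T0_ge0 : 0 <= T0)
    (y : R -> 'cV[R[i]]_n)
    (y_C1 : vC1 [set t | T0 < t] y)
    (y_sol : forall t, T0 < t ->
       is_vderive y t (- (A *m y t) + G (y t) + f t))
    (y_cvg0 : enorm (y t) @[t --> +oo] --> 0) :
  exists yk : nat -> R -> 'cV[R[i]]_n,
    [/\ forall k, FE (- mu k) (yk k),
        exp_expansion mu y yk &
        forall k t, exists2 dyk : 'cV[R[i]]_n,
          is_vderive (yk k) t dyk &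
          dyk + A *m yk k t = resonant_sum mu GG yk k t + fk k t].
Proof.
have [yk ykP] := full_expansion n_gt0 G_exp GG_lin GG_diag mu_gt0 mu_incr mu_add
  mu_spec fk_FE f_exp y_sol y_cvg0.
exists yk; split.
- by move=> k; have [/(_ k (ltnSn k))[]] := ykP k.+1.
(* Stage [N.+1] is the right one: its partial sum runs up to index [N] and its rate exceeds
   [mu N]. *)
- move=> N; have [_ [nu [_ _ _ nuP yO]]] := ykP N.+1.
  by exists nu; [exact: nuP | exact/vexpO_bigO].
- move=> k t; have [/(_ k (ltnSn k))[_ dyk] _] := ykP k.+1.
  exists (- (A *m yk k t) + (resonant_sum mu GG yk k t + fk k t)); first exact: dyk.
  by rewrite addrC addrA subrr add0r.
Qed.
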